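(* Let $\bar B=(B_0,B_1)$ be a Banach pair and let $\theta\in(0,1)$. For every $x\in B_0\cap B_1$, $$\|x\|_{[\bar B]_{\theta,\mathbb{A}}}=\inf\Big\{\|f\|_{\mathcal{F}_{\mathbb{A}}(\bar B)}:\ f \text{ is a Laurent polynomial } f(z)=\sum_{n=-N}^{N}z^nb_n \text{ with } N\ge 0,\ b_n\in B_0\cap B_1,\ f(e^\theta)=x\Big\}.$$
   Context: Banach spaces are over $\mathbb{C}$. A Banach pair $\bar B=(B_0,B_1)$ consists of two Banach spaces continuously embedded in some Hausdorff topological vector space. $\mathbb{A}=\{z\in\mathbb{C}:1\le|z|\le e\}$, $\mathbb{A}^\circ$ is its interior, and $\mathbb{T}$ is the unit circle. $\mathcal{F}_{\mathbb{A}}(\bar B)$ is the space of all continuous functions $f:\mathbb{A}\to B_0+B_1$ such that $f$ is analytic in $\mathbb{A}^\circ$ and, for $j=0,1$, the restriction of $f$ to the circle $e^j\mathbb{T}$ is a continuous map of $e^j\mathbb{T}$ into $B_j$. It is normed by $\|f\|_{\mathcal{F}_{\mathbb{A}}(\bar B)}=\sup\{\|f(e^{j+it})\|_{B_j}:t\in[0,2\pi),\ j=0,1\}$. $[\bar B]_{\theta,\mathbb{A}}$ (the annulus variant of Calderón's complex interpolation space) is the space of all $b\in B_0+B_1$ of the form $b=f(e^\theta)$ for some $f\in\mathcal{F}_{\mathbb{A}}(\bar B)$, normed by $\|b\|_{[\bar B]_{\theta,\mathbb{A}}}=\inf\{\|f\|_{\mathcal{F}_{\mathbb{A}}(\bar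 B)}:f\in\mathcal{F}_{\mathbb{A}}(\bar B),\ b=f(e^\theta)\}$. *)

(* Defs.v *)
From Stdlib Require Import Reals Lra ZArith ProofIrrelevance Classical.
From Coquelicot Require Import Coquelicot.
Open Scope R_scope.

Definition nbhs_of {T : Type} (op : (T -> Prop) -> Prop) (x : T)
  (P : T -> Prop) : Prop :=
  exists U, op U /\ U x /\ forall y, U y -> P y.

(* Coquelicot's uniform spaces are pseudometrizable, so the ambient topological
   vector space is given by its open sets instead. *)
Record HausdorffTVS : Type := {
  tvs_carrier :> ModuleSpace C_AbsRing;
  tvs_open : (tvs_carrier -> Prop) -> Prop;
  tvs_open_full : tvs_open (fun _ => True);
  tvs_open_and : forall U V, tvs_open U -> tvs_open V ->
    tvs_open (fun x => U x /\ V x);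
  tvs_open_union : forall F : (tvs_carrier -> Prop) -> Prop,
    (forall U, F U -> tvs_open U) -> tvs_open (fun x => exists U, F U /\ U x);
  tvs_plus_continuous : forall x y : tvs_carrier,
    filterlim (fun p : tvs_carrier * tvs_carrier => plus (fst p) (snd p))
      (filter_prod (nbhs_of tvs_open x) (nbhs_of tvs_open y))
      (nbhs_of tvs_open (plus x y));
  tvs_scal_continuous : forall (a : C_AbsRing) (x : tvs_carrier),
    filterlim (fun p : C_AbsRing * tvs_carrier => scal (fst p) (snd p))
      (filter_prod (locally a) (nbhs_of tvs_open x))
      (nbhs_of tvs_open (scal a x));
  tvs_hausdorff : forall x y : tvs_carrier, x <> y ->
    exists U V, tvs_open U /\ tvs_open V /\ U x /\ V y /\
      forall z, ~ (U z /\ V z)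
}.

Definition tvs_nbhs (E : HausdorffTVS) (x : E) : (E -> Prop) -> Prop :=
  nbhs_of (tvs_open E) x.

Record continuous_embedding (B : NormedModule C_AbsRing) (E : HausdorffTVS)
  (i : B -> E) : Prop := {
  emb_plus : forall x y, i (plus x y) = plus (i x) (i y);
  emb_scal : forall (a : C_AbsRing) x, i (scal a x) = scal a (i x);
  emb_inj : forall x y, i x = i y -> x = y;
  emb_cont : forall x, filterlim i (locally x) (tvs_nbhs E (i x))
}.

Record BanachPair : Type := {
  ambient : HausdorffTVS;
  banach0 : CompleteNormedModule C_AbsRing;
  banach1 : CompleteNormedModule C_AbsRing;
  emb0 : banach0 -> ambient;
  emb1 : banach1 -> ambient;
  emb0_embedding : continuous_embedding banach0 ambient emb0;
  emb1_embedding : continuous_embedding banach1 ambient emb1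
}.

Definition in_sum (P : BanachPair) (x : ambient P) : Prop :=
  exists (b0 : banach0 P) (b1 : banach1 P), x = plus (emb0 P b0) (emb1 P b1).

Definition sum_space (P : BanachPair) : Type := { x : ambient P | in_sum P x }.

Definition sum_val {P : BanachPair} (x : sum_space P) : ambient P := proj1_sig x.

Lemma sum_val_inj (P : BanachPair) (x y : sum_space P) :
  sum_val x = sum_val y -> x = y.
Proof.
  intros H. apply eq_sig_hprop; [intros; apply proof_irrelevance | exact H].
Qed.

Definition decomposition_norms (P : BanachPair) (x : ambient P) (r : R) : Prop :=
  exists (b0 : banach0 P) (b1 : banach1 P),
    x = plus (emb0 P b0) (emb1 P b1) /\ r = norm b0 + norm b1.

Definition sum_norm (P : BanachPair) (x : sum_space P) : R :=
  real (Glb_Rbar (decomposition_norms P (sum_val x))).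

Lemma emb_zero (B : NormedModule C_AbsRing) (E : HausdorffTVS) (i : B -> E) :
  continuous_embedding B E i -> i zero = zero.
Proof.
  intros H. transitivity (i (scal (zero : C_AbsRing) (zero : B))).
  - f_equal. symmetry. apply (scal_zero_l (zero : B)).
  - rewrite (emb_scal _ _ _ H). apply (scal_zero_l (i zero)).
Qed.

Lemma plus_swap (G : AbelianGroup) (a b c d : G) :
  plus (plus a b) (plus c d) = plus (plus a c) (plus b d).
Proof.
  rewrite <- !plus_assoc. f_equal. rewrite !plus_assoc. f_equal. apply plus_comm.
Qed.

Lemma emb_sum_plus (P : BanachPair) (a0 b0 : banach0 P) (a1 b1 : banach1 P) :
  plus (plus (emb0 P a0) (emb1 P a1)) (plus (emb0 P b0) (emb1 P b1)) =
  plus (emb0 P (plus a0 b0)) (emb1 P (plus a1 b1)).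
Proof.
  etransitivity; [apply plus_swap|]. symmetry. apply f_equal2.
  - apply (emb_plus _ _ _ (emb0_embedding P)).
  - apply (emb_plus _ _ _ (emb1_embedding P)).
Qed.

Lemma emb_sum_scal (P : BanachPair) (a : C_AbsRing) (b0 : banach0 P) (b1 : banach1 P) :
  scal a (plus (emb0 P b0) (emb1 P b1)) =
  plus (emb0 P (scal a b0)) (emb1 P (scal a b1)).
Proof.
  etransitivity; [apply scal_distr_l|]. symmetry. apply f_equal2.
  - apply (emb_scal _ _ _ (emb0_embedding P)).
  - apply (emb_scal _ _ _ (emb1_embedding P)).
Qed.

Lemma in_sum_zero (P : BanachPair) : in_sum P zero.
Proof.
  exists zero, zero.
  symmetry. etransitivity; [|apply plus_zero_l]. apply f_equal2.
  - apply (emb_zero _ _ _ (emb0_embedding P)).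
  - apply (emb_zero _ _ _ (emb1_embedding P)).
Qed.

Lemma in_sum_plus (P : BanachPair) (x y : ambient P) :
  in_sum P x -> in_sum P y -> in_sum P (plus x y).
Proof.
  intros (a0 & a1 & ->) (b0 & b1 & ->). exists (plus a0 b0), (plus a1 b1).
  apply emb_sum_plus.
Qed.

Lemma in_sum_scal (P : BanachPair) (a : C_AbsRing) (x : ambient P) :
  in_sum P x -> in_sum P (scal a x).
Proof.
  intros (b0 & b1 & ->). exists (scal a b0), (scal a b1).
  apply emb_sum_scal.
Qed.

Lemma in_sum_opp (P : BanachPair) (x : ambient P) :
  in_sum P x -> in_sum P (opp x).
Proof.
  intros H. rewrite <- scal_opp_one. now apply in_sum_scal.
Qed.

Definition sum_plus {P : BanachPair} (x y : sum_space P) : sum_space P :=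
  exist _ (plus (sum_val x) (sum_val y))
    (in_sum_plus P _ _ (proj2_sig x) (proj2_sig y)).
Definition sum_zero {P : BanachPair} : sum_space P :=
  exist _ zero (in_sum_zero P).
Definition sum_opp {P : BanachPair} (x : sum_space P) : sum_space P :=
  exist _ (opp (sum_val x)) (in_sum_opp P _ (proj2_sig x)).
Definition sum_scal {P : BanachPair} (a : C_AbsRing) (x : sum_space P) :
  sum_space P :=
  exist _ (scal a (sum_val x)) (in_sum_scal P a _ (proj2_sig x)).

Definition sum_AbelianMonoid_mixin (P : BanachPair) :
  AbelianMonoid.mixin_of (sum_space P).
Proof.
  apply (AbelianMonoid.Mixin _ sum_plus sum_zero);
    intros; apply sum_val_inj; simpl.
  - apply plus_comm.
  - apply plus_assoc.
  - apply plus_zero_r.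
Defined.
Canonical sum_AbelianMonoid (P : BanachPair) : AbelianMonoid :=
  AbelianMonoid.Pack (sum_space P) (sum_AbelianMonoid_mixin P) (sum_space P).

Definition sum_AbelianGroup_mixin (P : BanachPair) :
  AbelianGroup.mixin_of (sum_AbelianMonoid P).
Proof.
  apply (AbelianGroup.Mixin (sum_AbelianMonoid P) sum_opp).
  intros x; apply sum_val_inj; apply (plus_opp_r (sum_val x)).
Defined.
Canonical sum_AbelianGroup (P : BanachPair) : AbelianGroup :=
  AbelianGroup.Pack (sum_space P)
    (AbelianGroup.Class _ _ (sum_AbelianGroup_mixin P)) (sum_space P).

Definition sum_ModuleSpace_mixin (P : BanachPair) :
  ModuleSpace.mixin_of C_AbsRing (sum_AbelianGroup P).
Proof.
  apply (ModuleSpace.Mixin C_AbsRing (sum_AbelianGroup P) sum_scal);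
    intros; apply sum_val_inj; simpl.
  - apply (scal_assoc x y).
  - apply scal_one.
  - apply scal_distr_l.
  - apply (scal_distr_r x y).
Defined.
Canonical sum_ModuleSpace (P : BanachPair) : ModuleSpace C_AbsRing :=
  ModuleSpace.Pack C_AbsRing (sum_space P)
    (ModuleSpace.Class _ _ _ (sum_ModuleSpace_mixin P)) (sum_space P).

Lemma sum_norm_glb (P : BanachPair) (x : sum_space P) :
  is_glb_Rbar (decomposition_norms P (sum_val x)) (Finite (sum_norm P x)).
Proof.
  unfold sum_norm.
  pose proof (Glb_Rbar_correct (decomposition_norms P (sum_val x))) as H.
  destruct (Glb_Rbar _) as [r | |]; try exact H; exfalso; destruct H as [H1 H2].
  - destruct (proj2_sig x) as (b0 & b1 & E).
    apply (H1 (norm b0 + norm b1)). now exists b0, b1.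
  - apply (H2 (Finite 0)). intros r (b0 & b1 & _ & ->).
    pose proof (norm_ge_0 b0). pose proof (norm_ge_0 b1). simpl. lra.
Qed.

Lemma sum_norm_le (P : BanachPair) (x : sum_space P) b0 b1 :
  sum_val x = plus (emb0 P b0) (emb1 P b1) ->
  sum_norm P x <= norm b0 + norm b1.
Proof.
  intros E. apply (proj1 (sum_norm_glb P x)). now exists b0, b1.
Qed.

Lemma sum_norm_approx (P : BanachPair) (x : sum_space P) (eps : R) :
  0 < eps -> exists b0 b1, sum_val x = plus (emb0 P b0) (emb1 P b1) /\
    norm b0 + norm b1 < sum_norm P x + eps.
Proof.
  intros He. apply NNPP. intros Hn.
  assert (H : Rbar_le (Finite (sum_norm P x + eps)) (Finite (sum_norm P x))).
  { apply (proj2 (sum_norm_glb P x)). intros r (b0 & b1 & E & ->). simpl.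
    apply Rnot_lt_le. intros Hl. apply Hn. now exists b0, b1. }
  simpl in H. lra.
Qed.

Lemma sum_norm_ge_0 (P : BanachPair) (x : sum_space P) : 0 <= sum_norm P x.
Proof.
  apply (proj2 (sum_norm_glb P x) (Finite 0)). intros r (b0 & b1 & _ & ->).
  pose proof (norm_ge_0 b0). pose proof (norm_ge_0 b1). simpl. lra.
Qed.

Lemma sum_norm_triangle (P : BanachPair) (x y : sum_space P) :
  sum_norm P (plus x y) <= sum_norm P x + sum_norm P y.
Proof.
  apply le_epsilon. intros e He.
  destruct (sum_norm_approx P x (e/2)) as (a0 & a1 & Ea & Ha); [lra|].
  destruct (sum_norm_approx P y (e/2)) as (b0 & b1 & Eb & Hb); [lra|].
  apply Rle_trans with (norm (plus a0 b0) + norm (plus a1 b1)).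
  - apply sum_norm_le. simpl. rewrite Ea, Eb.
    apply emb_sum_plus.
  - apply Rle_trans with ((norm a0 + norm b0) + (norm a1 + norm b1)).
    + apply Rplus_le_compat; apply @norm_triangle.
    + lra.
Qed.

Lemma sum_norm_scal (P : BanachPair) (l : C_AbsRing) (x : sum_space P) :
  sum_norm P (scal l x) <= abs l * sum_norm P x.
Proof.
  pose proof (abs_ge_0 l) as Hl. apply le_epsilon. intros e He.
  assert (He' : 0 < e / (abs l + 1)) by (apply Rdiv_lt_0_compat; lra).
  destruct (sum_norm_approx P x _ He') as (b0 & b1 & E & H).
  apply Rle_trans with (norm (scal l b0) + norm (scal l b1)).
  - apply sum_norm_le. simpl. rewrite E.
    apply emb_sum_scal.
  - apply Rle_trans with (abs l * norm b0 + abs l * norm b1).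
    { apply Rplus_le_compat; apply @norm_scal. }
    assert (Hm : abs l * (norm b0 + norm b1) <=
                 abs l * (sum_norm P x + e / (abs l + 1)))
      by (apply Rmult_le_compat_l; lra).
    assert (Hq : e / (abs l + 1) * (abs l + 1) = e) by (field; lra).
    nra.
Qed.

Lemma sum_norm_opp (P : BanachPair) (x : sum_space P) :
  sum_norm P (opp x) <= sum_norm P x.
Proof.
  assert (E : opp x = scal (opp one : C_AbsRing) x)
    by (symmetry; apply (scal_opp_one (x : sum_ModuleSpace P))).
  rewrite E.
  eapply Rle_trans; [apply sum_norm_scal|].
  rewrite abs_opp_one. lra.
Qed.

Lemma sum_norm_zero (P : BanachPair) : sum_norm P zero = 0.
Proof.
  apply Rle_antisym; [|apply sum_norm_ge_0].
  assert (E : (zero : sum_space P) = scal (zero : C_AbsRing) (zero : sum_space P))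
    by (symmetry; apply (scal_zero_l (zero : sum_ModuleSpace P))).
  eapply Rle_trans; [apply Req_le, f_equal, E|].
  eapply Rle_trans; [apply sum_norm_scal|].
  rewrite abs_zero. lra.
Qed.

Lemma emb_small (B : NormedModule C_AbsRing) (E : HausdorffTVS) (i : B -> E)
  (W : E -> Prop) :
  continuous_embedding B E i -> tvs_nbhs E zero W ->
  exists d, 0 < d /\ forall b, norm b < d -> W (i b).
Proof.
  intros Hi HW. rewrite <- (emb_zero _ _ _ Hi) in HW.
  destruct (emb_cont _ _ _ Hi zero W HW) as [d Hd].
  exists d. split; [apply cond_pos|]. intros b Hb. apply Hd.
  apply norm_compat1. eapply Rle_lt_trans; [apply Req_le, f_equal | exact Hb].
  unfold minus. etransitivity; [|apply plus_zero_r].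
  apply f_equal. apply (@opp_zero B).
Qed.

Lemma sum_norm_eq_zero (P : BanachPair) (x : sum_space P) :
  sum_norm P x = 0 -> x = zero.
Proof.
  intros Hx. apply sum_val_inj. apply NNPP. intros Hne.
  destruct (tvs_hausdorff (ambient P) _ _ Hne) as (U & V & HU & HV & Ux & V0 & D).
  assert (HV0 : tvs_nbhs (ambient P) (plus zero zero) V).
  { exists V. rewrite plus_zero_l. now repeat split. }
  destruct (tvs_plus_continuous (ambient P) zero zero V HV0) as [W0 W1 H0 H1 HW].
  destruct (emb_small _ _ _ W0 (emb0_embedding P) H0) as (d0 & Hd0 & K0).
  destruct (emb_small _ _ _ W1 (emb1_embedding P) H1) as (d1 & Hd1 & K1).
  destruct (sum_norm_approx P x (Rmin d0 d1)) as (b0 & b1 & E & Hb).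
  { now apply Rmin_glb_lt. }
  pose proof (norm_ge_0 b0). pose proof (norm_ge_0 b1).
  pose proof (Rmin_l d0 d1). pose proof (Rmin_r d0 d1).
  apply (D (sum_val x)). split; [exact Ux|]. rewrite E.
  apply (HW (emb0 P b0) (emb1 P b1)); [apply K0 | apply K1]; lra.
Qed.

Definition sum_UniformSpace_mixin (P : BanachPair) :
  UniformSpace.mixin_of (sum_space P).
Proof.
  apply (UniformSpace.Mixin (sum_space P) zero
           (fun x eps y => sum_norm P (minus y x) < eps)).
  - intros x e. rewrite minus_eq_zero, sum_norm_zero. apply cond_pos.
  - intros x y e H. rewrite <- opp_minus.
    eapply Rle_lt_trans; [apply sum_norm_opp | exact H].
  - intros x y z e1 e2 H1 H2. rewrite (minus_trans y z x).
    eapply Rle_lt_trans; [apply sum_norm_triangle | lra].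
Defined.
Canonical sum_UniformSpace (P : BanachPair) : UniformSpace :=
  UniformSpace.Pack (sum_space P) (sum_UniformSpace_mixin P) (sum_space P).

Canonical sum_NormedModuleAux (P : BanachPair) : NormedModuleAux C_AbsRing :=
  NormedModuleAux.Pack C_AbsRing (sum_space P)
    (NormedModuleAux.Class _ _ (ModuleSpace.class _ (sum_ModuleSpace P))
       (sum_UniformSpace_mixin P)) (sum_space P).

Definition sum_NormedModule_mixin (P : BanachPair) :
  NormedModule.mixin_of C_AbsRing (sum_NormedModuleAux P).
Proof.
  apply (NormedModule.Mixin C_AbsRing (sum_NormedModuleAux P) (sum_norm P) 1).
  - apply sum_norm_triangle.
  - apply sum_norm_scal.
  - intros x y eps H. exact H.
  - intros x y eps H. rewrite Rmult_1_l. exact H.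
  - apply sum_norm_eq_zero.
Defined.
Canonical sum_NormedModule (P : BanachPair) : NormedModule C_AbsRing :=
  NormedModule.Pack C_AbsRing (sum_space P)
    (NormedModule.Class _ _ _ (sum_NormedModule_mixin P)) (sum_space P).

Definition in_intersection (P : BanachPair) (x : sum_space P) : Prop :=
  (exists b0 : banach0 P, sum_val x = emb0 P b0) /\
  (exists b1 : banach1 P, sum_val x = emb1 P b1).

Definition annulus (z : C_AbsRing) : Prop := 1 <= Cmod z <= exp 1.
Definition annulus_interior (z : C_AbsRing) : Prop := 1 < Cmod z < exp 1.
Definition circle (j : R) (z : C_AbsRing) : Prop := Cmod z = exp j.
Definition circle_point (j t : R) : C_AbsRing := (exp j * cos t, exp j * sin t).

(* The restriction of [f] to a circle takes its values in [B] and is continuous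
   for the norm of [B]. *)
Definition continuous_circle_into (P : BanachPair) (B : NormedModule C_AbsRing)
  (i : B -> ambient P) (j : R) (f : C_AbsRing -> sum_space P) : Prop :=
  exists g : C_AbsRing -> B,
    continuous_on (circle j) g /\
    forall z, circle j z -> sum_val (f z) = i (g z).

(* Functions on the annulus are total functions on C whose values outside the
   annulus are irrelevant. *)
Definition FA (P : BanachPair) (f : C_AbsRing -> sum_space P) : Prop :=
  continuous_on annulus f /\
  (forall z, annulus_interior z -> ex_derive f z) /\
  continuous_circle_into P (banach0 P) (emb0 P) 0 f /\
  continuous_circle_into P (banach1 P) (emb1 P) 1 f.

Definition circle_norms (P : BanachPair) (B : NormedModule C_AbsRing)
  (i : B -> ambient P) (j : R) (f : C_AbsRing -> sum_space P) (r : R) : Prop :=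
  exists (t : R) (b : B), 0 <= t < 2 * PI /\
    sum_val (f (circle_point j t)) = i b /\ r = norm b.

(* The supremum is finite for [f] in [FA]; a value in [Rbar] avoids the junk
   value 0 that [real] would give to an infinite supremum elsewhere. *)
Definition FA_norm (P : BanachPair) (f : C_AbsRing -> sum_space P) : Rbar :=
  Lub_Rbar (fun r => circle_norms P (banach0 P) (emb0 P) 0 f r \/
                     circle_norms P (banach1 P) (emb1 P) 1 f r).

(* [p_infty] when [b] is not in the interpolation space. *)
Definition interp_norm (P : BanachPair) (theta : R) (b : sum_space P) : Rbar :=
  Glb_Rbar (fun r => exists f, FA P f /\ f (RtoC (exp theta)) = b /\
                               FA_norm P f = Finite r).

Definition Czpow (z : C) (n : Z) : C :=
  match n with
  | Z0 => RtoC 1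
  | Zpos p => Cpow z (Pos.to_nat p)
  | Zneg p => Cinv (Cpow z (Pos.to_nat p))
  end.

(* The index n = k - N runs from -N to N as k runs from 0 to 2N. *)
Definition is_laurent_polynomial (P : BanachPair)
  (f : C_AbsRing -> sum_space P) : Prop :=
  exists (N : nat) (b : Z -> sum_space P),
    (forall n : Z, (- Z.of_nat N <= n <= Z.of_nat N)%Z ->
       in_intersection P (b n)) /\
    forall z, annulus z ->
      f z = sum_n (fun k : nat =>
                     let n := (Z.of_nat k - Z.of_nat N)%Z in
                     scal (Czpow z n : C_AbsRing) (b n)) (2 * N).

(* Main.v *)
Require Import Defs.
From Stdlib Require Import Reals Lra Lia ZArith List Classical ClassicalEpsilon
  FunctionalExtensionality PropExtensionality.
From Coquelicot Require Import Coquelicot.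
Open Scope R_scope.

(** Given [f] with [f p = x], where [p = e^theta], put [h z = (f z - x) / (z - p)] and
    [h p = f' p]. Since [x] lies in the intersection, [h] is again analytic on the
    annulus and continuous into [B_j] on the j-th circle. Goursat's theorem shows that the
    Fourier coefficients of [h] computed in [B_0] on the inner circle and in [B_1] on the
    outer circle agree, so they lie in the intersection. The Fejer means [h_N] of [h]
    converge to [h] uniformly on both circles, and the Laurent polynomials
    [x + (z - p) h_N z] take the value [x] at [p] exactly and converge to [f]. *)

(** * Linear identities in complex vector spaces *)

(** The value at [p] has to be exactly [x]. This rules out the Fejer means of [f] itself: their
    value at [p] is only near [x], and the defect need not be small in the norms of [B_0] and [B_1],
    so adding a constant cannot repair it. Approximating the quotient [h] instead makes the value at
    [p] automatic, and multiplying back costs only the factor [|z - p| <= 2 e]. The quotient has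
    continuous traces in [B_j] because [x] belongs to both spaces and [p] lies on neither circle.

    Fejer means are taken rather than partial Fourier sums because [h] is only continuous on the
    circles. The coefficients of the two circles live in different spaces and can be compared only
    in [B_0 + B_1], where [f] is analytic; hence this space is first shown to be complete, so that
    integrals exist in it. What is immediate for [h] at [p] is continuity, and Cauchy's theorem is
    therefore proved for continuous functions that may fail to be differentiable at [p]. *)

Inductive vexp : Type :=
| vvar (n : nat) | vzero | vplus (e1 e2 : vexp) | vminus (e1 e2 : vexp)
| vopp (e : vexp) | vscal (c : C) (e : vexp).

Fixpoint veval {V : ModuleSpace C_AbsRing} (l : list V) (e : vexp) : V :=
  match e with
  | vvar n => nth n l zero
  | vzero => zero
  | vplus a b => plus (veval l a) (veval l b)
  | vminus a b => minus (veval l a) (veval l b)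
  | vopp a => opp (veval l a)
  | vscal c a => scal (c : C_AbsRing) (veval l a)
  end.

Fixpoint vcoef (e : vexp) (k : nat) : C :=
  match e with
  | vvar n => if Nat.eqb n k then 1%C else 0%C
  | vzero => 0%C
  | vplus a b => Cplus (vcoef a k) (vcoef b k)
  | vminus a b => Cminus (vcoef a k) (vcoef b k)
  | vopp a => Copp (vcoef a k)
  | vscal c a => Cmult c (vcoef a k)
  end.

Fixpoint vlin {V : ModuleSpace C_AbsRing} (l : list V) (f : nat -> C) : V :=
  match l with
  | nil => zero
  | cons x l' => plus (scal (f O : C_AbsRing) x) (vlin l' (fun k => f (S k)))
  end.

Section VLin.
Context {V : ModuleSpace C_AbsRing}.

Lemma vlin_ext (l : list V) f g : (forall k, f k = g k) -> vlin l f = vlin l g.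
Proof.
  revert f g. induction l as [|x l IH]; intros f g H; simpl; trivial.
  rewrite H. f_equal. apply IH. intros; apply H.
Qed.

Lemma vlin_zero (l : list V) : vlin l (fun _ => 0%C) = zero.
Proof.
  induction l as [|x l IH]; simpl; trivial. rewrite IH, plus_zero_r. apply (scal_zero_l x).
Qed.

Lemma vlin_plus (l : list V) f g :
  vlin l (fun k => Cplus (f k) (g k)) = plus (vlin l f) (vlin l g).
Proof.
  revert f g. induction l as [|x l IH]; intros f g; simpl.
  - symmetry. apply plus_zero_l.
  - rewrite IH. etransitivity; [|apply (@plus_swap V)].
    apply f_equal2; [apply (scal_distr_r (f O : C_AbsRing) (g O) x) | reflexivity].
Qed.

Lemma vlin_scal (l : list V) (c : C) f :
  vlin l (fun k => Cmult c (f k)) = scal (c : C_AbsRing) (vlin l f).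
Proof.
  revert f. induction l as [|x l IH]; intros f; simpl.
  - symmetry. apply @scal_zero_r.
  - rewrite IH. etransitivity; [|symmetry; apply @scal_distr_l]. f_equal.
    symmetry. apply (scal_assoc (c : C_AbsRing) (f O) x).
Qed.

Lemma opp_scal_m1 (x : V) : opp x = scal (Copp 1 : C_AbsRing) x.
Proof. symmetry. apply (scal_opp_one x). Qed.

Lemma vlin_var (l : list V) n :
  vlin l (fun k => if Nat.eqb n k then 1%C else 0%C) = nth n l zero.
Proof.
  revert n. induction l as [|x l IH]; intros [|n]; simpl; trivial.
  - rewrite vlin_zero, plus_zero_r. apply (scal_one x).
  - rewrite IH. etransitivity; [|apply plus_zero_l]. f_equal. apply (scal_zero_l x).
Qed.

Lemma veval_vlin (l : list V) e : veval l e = vlin l (vcoef e).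
Proof.
  induction e; simpl.
  - symmetry. apply vlin_var.
  - symmetry. apply vlin_zero.
  - rewrite IHe1, IHe2. symmetry. apply vlin_plus.
  - rewrite IHe1, IHe2. unfold minus. rewrite opp_scal_m1, <- vlin_scal.
    rewrite <- vlin_plus. apply vlin_ext. intros; ring.
  - rewrite IHe, opp_scal_m1, <- vlin_scal. apply vlin_ext. intros; ring.
  - rewrite IHe. symmetry. apply vlin_scal.
Qed.

(** A conjunction with one scalar equation per atom, so that [repeat split] turns a vector identity
    into goals for [ring]. *)
Fixpoint vcheck (e1 e2 : vexp) (n : nat) : Prop :=
  match n with
  | O => True
  | S n' => vcoef e1 n' = vcoef e2 n' /\ vcheck e1 e2 n'
  end.

Lemma vcheck_spec e1 e2 n : vcheck e1 e2 n -> forall k, (k < n)%nat -> vcoef e1 k = vcoef e2 k.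
Proof.
  induction n as [|n IH]; intros H k Hk; [inversion Hk|]. destruct H as [H1 H2].
  destruct (Nat.eq_dec k n) as [->|]; trivial. apply IH; trivial.
  lia.
Qed.

Lemma vlin_ext_loc (l : list V) f g :
  (forall k, (k < length l)%nat -> f k = g k) -> vlin l f = vlin l g.
Proof.
  revert f g. induction l as [|x l IH]; intros f g H; simpl; trivial.
  rewrite (H O) by apply Nat.lt_0_succ. f_equal. apply IH. intros. apply H.
  now apply -> Nat.succ_lt_mono.
Qed.

Lemma veval_eq (l : list V) e1 e2 : vcheck e1 e2 (length l) -> veval l e1 = veval l e2.
Proof.
  intros H. rewrite !veval_vlin. apply vlin_ext_loc. now apply vcheck_spec.
Qed.
End VLin.

Ltac vmem x l :=
  match l with
  | nil => constr:(false)
  | cons x _ => constr:(true)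
  | cons _ ?l' => vmem x l'
  end.
Ltac vindex x l :=
  match l with
  | cons x _ => constr:(O)
  | cons _ ?l' => let n := vindex x l' in constr:(S n)
  end.
Ltac vatoms t l :=
  match t with
  | @plus _ ?a ?b => let l1 := vatoms a l in vatoms b l1
  | @minus _ ?a ?b => let l1 := vatoms a l in vatoms b l1
  | @opp _ ?a => vatoms a l
  | @scal _ _ _ ?a => vatoms a l
  | @zero _ => constr:(l)
  | _ => let b := vmem t l in
         match b with true => constr:(l) | false => constr:(cons t l) end
  end.
Ltac vreify t l :=
  match t with
  | @plus _ ?a ?b => let x := vreify a l in let y := vreify b l in constr:(vplus x y)
  | @minus _ ?a ?b => let x := vreify a l in let y := vreify b l in constr:(vminus x y)
  | @opp _ ?a => let x := vreify a l in constr:(vopp x)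
  | @scal _ _ ?c ?a => let x := vreify a l in constr:(vscal c x)
  | @zero _ => constr:(vzero)
  | _ => let n := vindex t l in constr:(vvar n)
  end.
(* [vring V] reduces an equation in the complex vector space [V] to the equality
   of the scalar coefficients of each atom. *)
Ltac vring_goals V :=
  match goal with |- ?a = ?b =>
    let l := vatoms a (@nil V) in let l := vatoms b l in
    let x := vreify a l in let y := vreify b l in
    change (@veval V l x = @veval V l y);
    apply veval_eq; cbv [vcheck length vcoef Nat.eqb]; repeat split
  end.
Ltac vring V := vring_goals V; ring.

Lemma plus_minus_r {V : ModuleSpace C_AbsRing} (x y : V) : plus x (minus y x) = y.
Proof. vring V. Qed.
Lemma minus_plus_l {V : ModuleSpace C_AbsRing} (x y z : V) : minus (plus x y) (plus x z) = minus y z.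
Proof. vring V. Qed.

(** * Vector-valued integrals *)

Section RestrictScalars.
Variable V : CompleteNormedModule C_AbsRing.

(** [is_RInt] takes values in a real normed space. Only the scalars are restricted here: addition,
    norm and uniform structure are those of [V], so limits and estimates pass between the two
    structures by conversion. *)
Definition real_ModuleSpace_mixin : ModuleSpace.mixin_of R_AbsRing V.
Proof.
  apply (ModuleSpace.Mixin R_AbsRing V (fun r v => scal (RtoC r : C_AbsRing) v)).
  - intros x y u. etransitivity; [apply scal_assoc|].
    apply (f_equal (fun c : C_AbsRing => scal c u)). symmetry. apply RtoC_mult.
  - intros u. apply (scal_one u).
  - intros x u v. apply @scal_distr_l.
  - intros x y u. etransitivity; [|apply @scal_distr_r].
    apply (f_equal (fun c : C_AbsRing => scal c u)). apply RtoC_plus.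
Defined.

Definition real_NormedModuleAux : NormedModuleAux R_AbsRing :=
  NormedModuleAux.Pack R_AbsRing V
    (NormedModuleAux.Class _ _
      (ModuleSpace.Class R_AbsRing V (AbelianGroup.class V) real_ModuleSpace_mixin)
      (UniformSpace.class V)) V.

Definition real_NormedModule_mixin :
  NormedModule.mixin_of R_AbsRing real_NormedModuleAux.
Proof.
  apply (NormedModule.Mixin R_AbsRing real_NormedModuleAux
    (@norm C_AbsRing V) (@norm_factor C_AbsRing V)).
  - apply @norm_triangle.
  - intros l x. eapply Rle_trans; [apply (norm_scal (RtoC l : C_AbsRing) (x : V))|].
    right. f_equal. apply Cmod_R.
  - apply @norm_compat1.
  - apply @norm_compat2.
  - apply @norm_eq_zero.
Defined.

Definition real_restriction : CompleteNormedModule R_AbsRing :=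
  CompleteNormedModule.Pack R_AbsRing V
    (CompleteNormedModule.Class R_AbsRing V
      (NormedModule.Class _ _ _ real_NormedModule_mixin)
      (CompleteSpace.class V)) V.
End RestrictScalars.

Definition is_integral {V : CompleteNormedModule C_AbsRing} (f : R -> V) (a b : R)
  (v : V) : Prop := @is_RInt (real_restriction V) f a b v.

Definition integral {V : CompleteNormedModule C_AbsRing} (f : R -> V) (a b : R) : V :=
  @RInt (real_restriction V) f a b.

(** A linear map commutes with every Riemann sum, and its continuity carries the limit. This is what
    moves integrals from [B_j] into the sum space. *)
Lemma is_RInt_linear (U V : NormedModule R_AbsRing) (l : U -> V) (f : R -> U)
  (a b : R) (u : U) :
  is_linear l -> is_RInt f a b u -> is_RInt (fun t => l (f t)) a b (l u).
Proof.
  intros Hl Hf.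
  assert (l0 : l zero = zero) by (apply linear_zero, Hl).
  assert (E : forall p, Riemann_sum (fun t => l (f t)) p = l (Riemann_sum f p)).
  { intros p. unfold Riemann_sum.
    match goal with |- context [seq.pairmap _ ?q _] => generalize q end.
    induction (SF_t p) as [|y s IH]; intros x; simpl; [symmetry; exact l0|].
    symmetry. etransitivity; [apply (linear_plus _ Hl)|].
    apply f_equal2; [apply (linear_scal _ Hl) | symmetry; apply IH]. }
  unfold is_RInt.
  apply filterlim_ext with (fun p => l (scal (sign (b - a)) (Riemann_sum f p))).
  { intros p. rewrite E. apply (linear_scal _ Hl). }
  eapply filterlim_comp; [exact Hf|].
  apply (linear_cont l u Hl).
Qed.

Section Integral.
Context {V : CompleteNormedModule C_AbsRing}.
Implicit Types f g : R -> V.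

Lemma is_integral_unique f a b v : is_integral f a b v -> integral f a b = v.
Proof. apply (@is_RInt_unique (real_restriction V)). Qed.

Lemma is_integral_integral f a b :
  (forall t, continuous f t) -> is_integral f a b (integral f a b).
Proof.
  intros H. apply (@RInt_correct (real_restriction V)).
  apply (@ex_RInt_continuous (real_restriction V)). intros; apply H.
Qed.

Lemma is_integral_ext f g a b v :
  (forall t, f t = g t) -> is_integral f a b v -> is_integral g a b v.
Proof. intros H. apply (@is_RInt_ext (real_restriction V)). intros; apply H. Qed.

Lemma is_integral_plus f g a b u v : is_integral f a b u -> is_integral g a b v ->
  is_integral (fun t => plus (f t) (g t)) a b (plus u v).
Proof. apply (@is_RInt_plus (real_restriction V)). Qed.

Lemma is_integral_minus f g a b u v : is_integral f a b u -> is_integral g a b v ->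
  is_integral (fun t => minus (f t) (g t)) a b (minus u v).
Proof. apply (@is_RInt_minus (real_restriction V)). Qed.

Lemma is_integral_const (v : V) a b :
  is_integral (fun _ => v) a b (scal (RtoC (b - a) : C_AbsRing) v).
Proof. apply (@is_RInt_const (real_restriction V)). Qed.

Lemma is_integral_Chasles f a b c u v : is_integral f a b u -> is_integral f b c v ->
  is_integral f a c (plus u v).
Proof. apply (@is_RInt_Chasles (real_restriction V)). Qed.

Lemma is_integral_bound f (g : R -> R) a b v l : a <= b ->
  (forall t, a <= t <= b -> norm (f t) <= g t) ->
  is_integral f a b v -> is_RInt g a b l -> norm v <= l.
Proof. apply (@norm_RInt_le (real_restriction V)). Qed.

Lemma is_integral_near_const f a b v e w : a <= b ->
  (forall t, a <= t <= b -> norm (minus (f t) w) <= e) ->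
  is_integral f a b v -> norm (minus v (scal (RtoC (b - a) : C_AbsRing) w)) <= (b - a) * e.
Proof.
  intros Hab He Hf.
  apply is_integral_bound with (fun t => minus (f t) w) (fun _ => e) a b; trivial.
  - apply is_integral_minus; [exact Hf | apply is_integral_const].
  - apply (@is_RInt_const R_NormedModule).
Qed.

Lemma is_integral_linear (W : CompleteNormedModule C_AbsRing) (l : V -> W) f a b v :
  (forall x y, l (plus x y) = plus (l x) (l y)) ->
  (forall (r : R) x, l (scal (RtoC r : C_AbsRing) x) = scal (RtoC r : C_AbsRing) (l x)) ->
  (exists M, 0 < M /\ forall x, norm (l x) <= M * norm x) ->
  is_integral f a b v -> is_integral (fun t => l (f t)) a b (l v).
Proof.
  intros H1 H2 H3. apply (is_RInt_linear (real_restriction V) (real_restriction W)).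
  split; assumption.
Qed.

Lemma is_integral_scal (c : C_AbsRing) f a b v : is_integral f a b v ->
  is_integral (fun t => scal c (f t)) a b (scal c v).
Proof.
  apply is_integral_linear.
  - intros; apply @scal_distr_l.
  - intros. rewrite !scal_assoc. f_equal. apply Cmult_comm.
  - exists (abs c + 1). pose proof (abs_ge_0 c). split; [lra|]. intros x.
    eapply Rle_trans; [apply @norm_scal|]. apply Rmult_le_compat_r; [apply norm_ge_0|lra].
Qed.

Lemma is_integral_scal_r (g : R -> R) a b (l : R) (v : V) : is_RInt g a b l ->
  is_integral (fun t => scal (RtoC (g t) : C_AbsRing) v) a b (scal (RtoC l : C_AbsRing) v).
Proof.
  apply (is_RInt_linear R_NormedModule (real_restriction V)
           (fun r => scal (RtoC r : C_AbsRing) v : real_restriction V)).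
  split.
  - intros x y. etransitivity; [|apply (scal_distr_r (RtoC x : C_AbsRing) (RtoC y) v)].
    f_equal. apply RtoC_plus.
  - intros k x. etransitivity; [|symmetry; apply (scal_assoc (RtoC k : C_AbsRing) (RtoC x) v)].
    f_equal. apply RtoC_mult.
  - exists (norm v + 1). pose proof (norm_ge_0 v). split; [lra|]. intros x.
    eapply Rle_trans; [apply (norm_scal (RtoC x : C_AbsRing) v)|].
    change (abs (RtoC x : C_AbsRing)) with (Cmod (RtoC x)).
    rewrite Cmod_R, Rmult_comm. apply Rmult_le_compat_r; [apply Rabs_pos|lra].
Qed.

Lemma is_integral_sum_n (f : nat -> R -> V) a b (v : nat -> V) N :
  (forall k, is_integral (f k) a b (v k)) ->
  is_integral (fun t => sum_n (fun k => f k t) N) a b (sum_n v N).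
Proof.
  intros H. induction N as [|N IH].
  - rewrite sum_O. eapply is_integral_ext; [|apply H]. intros; now rewrite sum_O.
  - rewrite sum_Sn. eapply is_integral_ext; [|apply is_integral_plus; [apply IH|apply H]].
    intros; now rewrite sum_Sn.
Qed.
End Integral.

(** * Completeness of the sum space *)

Section SumSpaceComplete.
Variable P : BanachPair.

Definition incl0 (b : banach0 P) : sum_space P :=
  exist _ (emb0 P b) (ex_intro _ b (ex_intro _ zero
    (eq_sym (eq_trans (f_equal (plus (emb0 P b)) (emb_zero _ _ _ (emb1_embedding P)))
      (plus_zero_r _))))).
Definition incl1 (b : banach1 P) : sum_space P :=
  exist _ (emb1 P b) (ex_intro _ zero (ex_intro _ b
    (eq_sym (eq_trans (f_equal (fun v => plus v (emb1 P b)) (emb_zero _ _ _ (emb0_embedding P)))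
      (plus_zero_l _))))).

Lemma incl0_plus x y : incl0 (plus x y) = plus (incl0 x) (incl0 y).
Proof. apply sum_val_inj. apply (emb_plus _ _ _ (emb0_embedding P)). Qed.
Lemma incl1_plus x y : incl1 (plus x y) = plus (incl1 x) (incl1 y).
Proof. apply sum_val_inj. apply (emb_plus _ _ _ (emb1_embedding P)). Qed.
Lemma incl0_scal a x : incl0 (scal a x) = scal a (incl0 x).
Proof. apply sum_val_inj. apply (emb_scal _ _ _ (emb0_embedding P)). Qed.
Lemma incl1_scal a x : incl1 (scal a x) = scal a (incl1 x).
Proof. apply sum_val_inj. apply (emb_scal _ _ _ (emb1_embedding P)). Qed.
Lemma incl0_norm x : norm (incl0 x) <= norm x.
Proof.
  apply Rle_trans with (norm x + norm (zero : banach1 P)).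
  - apply sum_norm_le. simpl. symmetry.
    etransitivity; [apply f_equal, (emb_zero _ _ _ (emb1_embedding P)) | apply plus_zero_r].
  - right. etransitivity; [apply f_equal, (@norm_zero _ (banach1 P)) | apply Rplus_0_r].
Qed.
Lemma incl1_norm x : norm (incl1 x) <= norm x.
Proof.
  apply Rle_trans with (norm (zero : banach0 P) + norm x).
  - apply sum_norm_le. simpl. symmetry.
    etransitivity; [apply (f_equal (fun v => plus v (emb1 P x))), (emb_zero _ _ _ (emb0_embedding P))
                   | apply plus_zero_l].
  - right. etransitivity; [apply (f_equal (fun r => r + norm x)), (@norm_zero _ (banach0 P))
                          | apply Rplus_0_l].
Qed.

(** The strict inequality leaves room to split each [d n] into components of total norm below [r n].
    The two component series converge absolutely in the Banach spaces [B_0] and [B_1], and the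
    bounded inclusions carry their sums over. *)
Lemma summable_decomposition (d : nat -> sum_space P) (r : nat -> R) :
  (forall n, norm (d n) < r n) -> ex_series r -> ex_series d.
Proof.
  intros Hd Hr.
  assert (K : forall n, exists p : banach0 P * banach1 P,
    d n = plus (incl0 (fst p)) (incl1 (snd p)) /\ norm (fst p) + norm (snd p) < r n).
  { intros n. destruct (sum_norm_approx P (d n) (r n - norm (d n))) as (a & b & E & L).
    { specialize (Hd n). lra. }
    exists (a, b). split; [apply sum_val_inj; exact E|].
    change (norm (d n)) with (sum_norm P (d n)) in L. simpl. lra. }
  destruct (choice _ K) as [p Hp].
  assert (H0 : ex_series (fun n => fst (p n))).
  { apply ex_series_le with r; trivial. intros n. destruct (Hp n) as [_ L].
    pose proof (norm_ge_0 (snd (p n))). lra. }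
  assert (H1 : ex_series (fun n => snd (p n))).
  { apply ex_series_le with r; trivial. intros n. destruct (Hp n) as [_ L].
    pose proof (norm_ge_0 (fst (p n))). lra. }
  destruct H0 as [A HA], H1 as [B HB].
  exists (plus (incl0 A) (incl1 B)).
  apply is_series_ext with (fun n => plus (incl0 (fst (p n))) (incl1 (snd (p n)))).
  { intros n. symmetry. apply Hp. }
  assert (lin0 : is_linear incl0).
  { split; [apply incl0_plus | apply incl0_scal | exists 1; split; [lra|]].
    intros; rewrite Rmult_1_l. apply incl0_norm. }
  assert (lin1 : is_linear incl1).
  { split; [apply incl1_plus | apply incl1_scal | exists 1; split; [lra|]].
    intros; rewrite Rmult_1_l. apply incl1_norm. }
  apply (@is_series_plus C_AbsRing (sum_NormedModule P)).
  - unfold is_series. eapply filterlim_ext; [|eapply filterlim_comp; [exact HA|apply (linear_cont incl0 A lin0)]].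
    intros n. simpl. induction n as [|n IH]; [now rewrite !sum_O|].
    rewrite !sum_Sn, incl0_plus, IH. reflexivity.
  - unfold is_series. eapply filterlim_ext; [|eapply filterlim_comp; [exact HB|apply (linear_cont incl1 B lin1)]].
    intros n. simpl. induction n as [|n IH]; [now rewrite !sum_O|].
    rewrite !sum_Sn, incl1_plus, IH. reflexivity.
Qed.

Lemma ball_sum_space (x y : sum_space P) (e : R) : ball x e y <-> norm (minus y x) < e.
Proof. reflexivity. Qed.

(** Completeness through absolutely convergent series: centres of balls of radius [2^-n] belonging
    to [F] form a fast Cauchy sequence, whose increments are summable. *)
Lemma sum_space_cauchy_lim (F : (sum_space P -> Prop) -> Prop) :
  ProperFilter F -> cauchy F -> exists x, forall eps : posreal, F (ball x eps).
Proof.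
  intros HF HC.
  assert (Hp : forall n, 0 < (1/2)^n) by (intros; apply pow_lt; lra).
  assert (K : forall n, exists y, F (ball y (mkposreal _ (Hp n)))) by (intros; apply HC).
  destruct (choice _ K) as [y Hy].
  pose (d n := minus (y (S n)) (y n)).
  assert (Hd : forall n, norm (d n) < 2 * (1/2)^n).
  (* Two sets of a proper filter meet, so consecutive centres differ by less than
     [2^-n + 2^-(n+1)]. *)
  { intros n. destruct (filter_ex _ (filter_and _ _ (Hy n) (Hy (S n)))) as [z [H1 H2]].
    assert (B := ball_triangle _ _ _ _ _ H1 (ball_sym _ _ _ H2)).
    apply ball_sum_space in B. simpl in B. unfold d.
    eapply Rlt_le_trans; [exact B|]. pose proof (Hp n). simpl. lra. }
  destruct (summable_decomposition d _ Hd) as [D HD].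
  { apply (ex_series_scal 2 (fun n => (1/2)^n)). apply ex_series_geom.
    rewrite Rabs_pos_eq; lra. }
  exists (plus (y O) D). intros eps.
  assert (He : 0 < eps / 2) by (pose proof (cond_pos eps); lra).
  destruct (proj1 (filterlim_locally_ball_norm _ _) HD (mkposreal _ He)) as [N1 H1].
  destruct (is_lim_seq_geom (1/2)) with (P := fun u => u < eps / 2) as [N2 H2].
  { rewrite Rabs_pos_eq; lra. }
  { exists (mkposreal _ He). intros u Hu. apply Rabs_lt_between' in Hu. simpl in Hu. lra. }
  set (n := (N1 + N2)%nat).
  assert (E : forall n, plus (y O) (sum_n d n) = y (S n)).
  { clear. intros n. induction n as [|n IH].
    - rewrite sum_O. apply (@plus_minus_r (sum_ModuleSpace P) (y O)).
    - rewrite sum_Sn, plus_assoc, IH. apply (@plus_minus_r (sum_ModuleSpace P) (y (S n))). }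
  apply filter_imp with (2 := Hy (S n)). intros z Hz.
  replace (pos eps) with (eps / 2 + eps / 2) by field.
  apply ball_triangle with (y (S n)).
  - apply ball_sum_space. rewrite <- E.
    specialize (H1 n ltac:(lia)). unfold ball_norm in H1. simpl in H1.
    rewrite (@minus_plus_l (sum_ModuleSpace P)). exact H1.
  - apply ball_le with (2 := Hz). simpl.
    specialize (H2 n ltac:(lia)). pose proof (Hp n). simpl in H2. lra.
Qed.

Definition sum_CompleteSpace_mixin : CompleteSpace.mixin_of (sum_UniformSpace P).
Proof.
  apply (CompleteSpace.Mixin (sum_UniformSpace P)
    (fun F => epsilon (inhabits (zero : sum_space P))
       (fun x => forall eps : posreal, F (ball x eps)))).
  - intros F HF HC. apply epsilon_spec. now apply sum_space_cauchy_lim.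
  - intros F1 F2 H1 H2.
    (* The limit is selected by [epsilon] from the filter alone, so once the filters are equal as
       predicates their limits coincide. *)
    assert (E : F1 = F2).
    { apply functional_extensionality. intros A. apply propositional_extensionality.
      split; [apply H2 | apply H1]. }
    rewrite E. intros e. apply ball_center.
Qed.

Definition sum_CompleteNormedModule : CompleteNormedModule C_AbsRing :=
  CompleteNormedModule.Pack C_AbsRing (sum_space P)
    (CompleteNormedModule.Class _ _ (NormedModule.class _ (sum_NormedModule P))
       sum_CompleteSpace_mixin) (sum_space P).
End SumSpaceComplete.

(** * Goursat's theorem *)

Lemma nested_intervals_point (a w : nat -> R) :
  (forall k, 0 <= w k) -> (forall k, a k <= a (S k)) ->
  (forall k, a (S k) + w (S k) <= a k + w k) ->
  exists s, forall k, a k <= s <= a k + w k.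
Proof.
  intros Hw Ha Hb.
  assert (Hi : forall k m, a k <= a (k + m)%nat).
  { intros k m. induction m as [|m IH]; [rewrite Nat.add_0_r; lra|].
    rewrite Nat.add_succ_r. specialize (Ha (k + m)%nat). lra. }
  assert (Hd : forall k m, a (k + m)%nat + w (k + m)%nat <= a k + w k).
  { intros k m. induction m as [|m IH]; [rewrite Nat.add_0_r; lra|].
    rewrite Nat.add_succ_r. specialize (Hb (k + m)%nat). lra. }
  assert (Hk : forall k m, a m <= a k + w k).
  { intros k m. specialize (Hi m k). specialize (Hd k m). specialize (Hw (k + m)%nat).
    rewrite (Nat.add_comm m k) in Hi. lra. }
  destruct (completeness (fun x => exists k, x = a k)) as [s [H1 H2]].
  - exists (a O + w O). intros x [k ->]. apply Hk.
  - exists (a O). now exists O.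
  - exists s. intros k. split.
    + apply H1. now exists k.
    + apply H2. intros x [m ->]. apply Hk.
Qed.

(** Goursat's bisection as an induction principle, for rectangles with lower left corner [(a, c)],
    width [w] and height [h]. If [Q] failed, some quarter would fail at each stage, and the nested
    failing rectangles would shrink to a point where the local hypothesis is violated. *)
Lemma rectangle_bisection (Q : R -> R -> R -> R -> Prop) (a c w h : R) :
  0 <= w -> 0 <= h ->
  (forall a c w h, Q a c (w / 2) (h / 2) -> Q (a + w / 2) c (w / 2) (h / 2) ->
     Q a (c + h / 2) (w / 2) (h / 2) -> Q (a + w / 2) (c + h / 2) (w / 2) (h / 2) ->
     Q a c w h) ->
  (forall s t, a <= s <= a + w -> c <= t <= c + h -> exists d, 0 < d /\
     forall a' c' w' h', 0 <= w' < d -> 0 <= h' < d ->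
       a' <= s <= a' + w' -> c' <= t <= c' + h' -> Q a' c' w' h') ->
  Q a c w h.
Proof.
  intros Hw Hh Hstep Hloc. apply NNPP. intros Hn.
  pose (W k := w / 2 ^ k). pose (H k := h / 2 ^ k).
  assert (p2 : forall k, 0 < 2 ^ k) by (intros; apply pow_lt; lra).
  assert (WS : forall k, W k / 2 = W (S k)).
  { intros k. unfold W. simpl. specialize (p2 k). field. lra. }
  assert (HS : forall k, H k / 2 = H (S k)).
  { intros k. unfold H. simpl. specialize (p2 k). field. lra. }
  assert (W0 : forall k, 0 <= W k) by (intros; apply Rdiv_le_0_compat; auto).
  assert (H0 : forall k, 0 <= H k) by (intros; apply Rdiv_le_0_compat; auto).
  (* Failure of [Q] is a premise inside the existential, so a successor exists for every pair and
     [choice] yields a total function to iterate. *)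
  assert (K : forall (kp : nat * (R * R)), exists p' : R * R,
    let k := fst kp in let p := snd kp in
    ~ Q (fst p) (snd p) (W k) (H k) ->
    ~ Q (fst p') (snd p') (W (S k)) (H (S k)) /\
    (fst p <= fst p' <= fst p + W (S k)) /\ (snd p <= snd p' <= snd p + H (S k))).
  { intros [k [x y]]. simpl.
    destruct (classic (Q x y (W k) (H k))) as [q|q]; [now exists (x, y)|].
    assert (N : ~ (Q x y (W (S k)) (H (S k)) /\ Q (x + W (S k)) y (W (S k)) (H (S k)) /\
      Q x (y + H (S k)) (W (S k)) (H (S k)) /\
      Q (x + W (S k)) (y + H (S k)) (W (S k)) (H (S k)))).
    { intros (q1 & q2 & q3 & q4). apply q. apply Hstep; rewrite ?WS, ?HS; trivial. }
    pose proof (W0 (S k)). pose proof (H0 (S k)).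
    destruct (classic (Q x y (W (S k)) (H (S k)))) as [q1|q1].
    2:{ exists (x, y). simpl. repeat split; trivial; lra. }
    destruct (classic (Q (x + W (S k)) y (W (S k)) (H (S k)))) as [q2|q2].
    2:{ exists (x + W (S k), y). simpl. repeat split; trivial; lra. }
    destruct (classic (Q x (y + H (S k)) (W (S k)) (H (S k)))) as [q3|q3].
    2:{ exists (x, y + H (S k)). simpl. repeat split; trivial; lra. }
    exists (x + W (S k), y + H (S k)). simpl. repeat split; try tauto; lra. }
  destruct (choice _ K) as [next Hnext].
  pose (p := fix p k := match k with O => (a, c) | S k' => next (k', p k') end).
  assert (Hp : forall k, ~ Q (fst (p k)) (snd (p k)) (W k) (H k)).
  { induction k as [|k IH].
    - simpl. unfold W, H. simpl. now rewrite !Rdiv_1_r.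
    - apply (Hnext (k, p k)). exact IH. }
  assert (Hq : forall k, fst (p k) <= fst (p (S k)) <= fst (p k) + W (S k) /\
                         snd (p k) <= snd (p (S k)) <= snd (p k) + H (S k)).
  { intros k. apply (Hnext (k, p k)). apply Hp. }
  destruct (nested_intervals_point (fun k => fst (p k)) W) as [s Hs]; trivial.
  { intros k. apply Hq. }
  { intros k. specialize (Hq k). specialize (WS k). lra. }
  destruct (nested_intervals_point (fun k => snd (p k)) H) as [t Ht]; trivial.
  { intros k. apply Hq. }
  { intros k. specialize (Hq k). specialize (HS k). lra. }
  destruct (Hloc s t) as (d & Hd & Hdd).
  { specialize (Hs O). unfold W in Hs. simpl in Hs. rewrite Rdiv_1_r in Hs. exact Hs. }
  { specialize (Ht O). unfold H in Ht. simpl in Ht. rewrite Rdiv_1_r in Ht. exact Ht. }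
  assert (small : forall x, 0 <= x -> exists N, forall k, (N <= k)%nat -> x / 2 ^ k < d).
  { intros x Hx.
    destruct (is_lim_seq_geom (1/2)) with (P := fun u => u < d / (x + 1)) as [N HN].
    { rewrite Rabs_pos_eq; lra. }
    { assert (He : 0 < d / (x + 1)) by (apply Rdiv_lt_0_compat; lra).
      exists (mkposreal _ He). intros u Hu. apply Rabs_lt_between' in Hu. simpl in Hu. lra. }
    exists N. intros k Hk. specialize (HN k Hk). simpl in HN.
    replace ((1/2)^k) with (/ 2 ^ k) in HN.
    2:{ unfold Rdiv. rewrite Rmult_1_l, pow_inv. trivial. }
    assert (i2 : 0 < / 2 ^ k) by (apply Rinv_0_lt_compat; auto).
    apply Rle_lt_trans with ((x + 1) * / 2 ^ k).
    - unfold Rdiv. apply Rmult_le_compat_r; lra.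
    - apply Rmult_lt_compat_l with (r := x + 1) in HN; [|lra].
      replace ((x + 1) * (d / (x + 1))) with d in HN by (field; lra). exact HN. }
  destruct (small w Hw) as [N1 S1]. destruct (small h Hh) as [N2 S2].
  apply (Hp (N1 + N2)%nat). apply Hdd; trivial.
  - split; [apply W0 | apply S1; lia].
  - split; [apply H0 | apply S2; lia].
Qed.

Definition jointly_continuous {V : NormedModule C_AbsRing} (F : R -> R -> V) : Prop :=
  forall s t eps, 0 < eps -> exists d, 0 < d /\ forall s' t',
    Rabs (s' - s) < d -> Rabs (t' - t) < d -> norm (minus (F s' t') (F s t)) < eps.

(* Holomorphy in the variable [s + i t]. *)
Definition log_derivable {V : NormedModule C_AbsRing} (F : R -> R -> V) (s t : R) : Prop :=
  exists D : V, forall eps, 0 < eps -> exists d, 0 < d /\ forall s' t',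
    Rabs (s' - s) < d -> Rabs (t' - t) < d ->
    norm (minus (minus (F s' t') (F s t)) (scal ((s' - s, t' - t) : C_AbsRing) D))
      <= eps * (Rabs (s' - s) + Rabs (t' - t)).

Lemma continuous_eps {V : NormedModule C_AbsRing} (f : R -> V) (t : R) :
  (forall eps, 0 < eps -> exists d, 0 < d /\ forall t', Rabs (t' - t) < d ->
     norm (minus (f t') (f t)) < eps) -> continuous f t.
Proof.
  intros H. apply filterlim_locally_ball_norm. intros eps.
  destruct (H eps (cond_pos eps)) as (d & Hd & K).
  exists (mkposreal d Hd). intros y Hy. apply K. exact Hy.
Qed.

Section Goursat.
Context {V : CompleteNormedModule C_AbsRing}.
Variable F : R -> R -> V.
Hypothesis HF : jointly_continuous F.

Lemma jointly_continuous_l t s : continuous (fun s => F s t) s.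
Proof.
  apply (@continuous_eps V). intros e He. destruct (HF s t e He) as (d & Hd & K).
  exists d. split; trivial. intros s' H. apply K; trivial.
  rewrite Rminus_diag, Rabs_R0. exact Hd.
Qed.
Lemma jointly_continuous_r s t : continuous (fun t => F s t) t.
Proof.
  apply (@continuous_eps V). intros e He. destruct (HF s t e He) as (d & Hd & K).
  exists d. split; trivial. intros s' H. apply K; trivial.
  rewrite Rminus_diag, Rabs_R0. exact Hd.
Qed.

(** The counterclockwise contour integral of [F d(s + i t)] around the rectangle: bottom minus top,
    plus [i] times right minus left. *)
Definition boundary_integral (a c w h : R) : V :=
  plus (minus (integral (fun s => F s c) a (a + w)) (integral (fun s => F s (c + h)) a (a + w)))
    (scal (Ci : C_AbsRing)
      (minus (integral (fun t => F (a + w) t) c (c + h)) (integral (fun t => F a t) c (c + h)))).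

Lemma integral_split (f : R -> V) a b c : (forall t, continuous f t) ->
  integral f a c = plus (integral f a b) (integral f b c).
Proof.
  intros H. apply is_integral_unique.
  apply is_integral_Chasles with b; now apply is_integral_integral.
Qed.

(** Each inner side is traversed twice in opposite directions and cancels; the outer sides add up by
    splitting the four integrals at their midpoints. *)
Lemma boundary_integral_quarters a c w h :
  boundary_integral a c w h =
  plus (plus (boundary_integral a c (w / 2) (h / 2))
             (boundary_integral (a + w / 2) c (w / 2) (h / 2)))
       (plus (boundary_integral a (c + h / 2) (w / 2) (h / 2))
             (boundary_integral (a + w / 2) (c + h / 2) (w / 2) (h / 2))).
Proof.
  unfold boundary_integral.
  replace (a + w / 2 + w / 2) with (a + w) by field.
  replace (c + h / 2 + h / 2) with (c + h) by field.
  rewrite (integral_split _ a (a + w / 2) (a + w)) by apply jointly_continuous_l.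
  rewrite (integral_split (fun s => F s (c + h)) a (a + w / 2) (a + w))
    by apply jointly_continuous_l.
  rewrite (integral_split _ c (c + h / 2) (c + h)) by apply jointly_continuous_r.
  rewrite (integral_split (fun t => F a t) c (c + h / 2) (c + h))
    by apply jointly_continuous_r.
  vring V.
Qed.

Lemma norm_minus_le (x y : V) : norm (minus x y) <= norm x + norm y.
Proof. unfold minus. eapply Rle_trans; [apply @norm_triangle|].
  apply Rplus_le_compat_l. right. apply @norm_opp. Qed.

(* Subtracting opposite sides before integrating turns the affine part of [F] into a
   constant, so no integral of an affine function has to be computed. *)
Lemma boundary_integral_small s t :
  log_derivable F s t -> forall eps, 0 < eps -> exists d, 0 < d /\
  forall a c w h, 0 <= w < d -> 0 <= h < d -> a <= s <= a + w -> c <= t <= c + h ->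
  norm (boundary_integral a c w h) <= eps * (w + h) ^ 2.
Proof.
  intros [D HD] eps He. destruct (HD (eps / 2)) as (d & Hd & K); [lra|].
  exists d. split; trivial. intros a c w h Hw Hh Hs Ht.
  assert (B : forall x y, a <= x <= a + w -> c <= y <= c + h ->
    norm (minus (minus (F x y) (F s t)) (scal ((x - s, y - t) : C_AbsRing) D))
      <= eps / 2 * (w + h)).
  { intros x y Hx Hy.
    assert (X : Rabs (x - s) <= w) by (apply Rabs_le; lra).
    assert (Y : Rabs (y - t) <= h) by (apply Rabs_le; lra).
    eapply Rle_trans; [apply K; lra|]. apply Rmult_le_compat_l; lra. }
  unfold boundary_integral.
  pose proof (fun t => is_integral_integral _ a (a + w) (jointly_continuous_l t)) as I1.
  pose proof (fun s => is_integral_integral _ c (c + h) (jointly_continuous_r s)) as I2.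
  cbv beta in I1, I2.
  pose proof (is_integral_minus _ _ _ _ _ _ (I1 c) (I1 (c + h))) as J1.
  pose proof (is_integral_minus _ _ _ _ _ _ (I2 (a + w)) (I2 a)) as J2.
  set (v1 := minus _ _) in J1 |- *. set (v2 := minus (integral (fun t => F (a + w) t) c (c + h)) _) in J2 |- *.
  apply (is_integral_near_const _ _ _ _ (eps * (w + h)) (scal ((0, - h) : C_AbsRing) D)) in J1;
    [|lra|].
  2:{ intros x Hx.
      replace (minus (minus (F x c) (F x (c + h))) (scal ((0, - h) : C_AbsRing) D)) with
        (minus (minus (minus (F x c) (F s t)) (scal ((x - s, c - t) : C_AbsRing) D))
          (minus (minus (F x (c + h)) (F s t)) (scal ((x - s, c + h - t) : C_AbsRing) D))).
      2:{ vring_goals V; unfold Cplus, Cminus, Copp, Cmult; simpl; apply injective_projections; simpl; ring. }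
      eapply Rle_trans; [apply norm_minus_le|].
      pose proof (B x c). pose proof (B x (c + h)). lra. }
  apply (is_integral_near_const _ _ _ _ (eps * (w + h)) (scal ((w, 0) : C_AbsRing) D)) in J2;
    [|lra|].
  2:{ intros y Hy.
      replace (minus (minus (F (a + w) y) (F a y)) (scal ((w, 0) : C_AbsRing) D)) with
        (minus (minus (minus (F (a + w) y) (F s t)) (scal ((a + w - s, y - t) : C_AbsRing) D))
          (minus (minus (F a y) (F s t)) (scal ((a - s, y - t) : C_AbsRing) D))).
      2:{ vring_goals V; unfold Cplus, Cminus, Copp, Cmult; simpl; apply injective_projections; simpl; ring. }
      eapply Rle_trans; [apply norm_minus_le|].
      pose proof (B (a + w) y). pose proof (B a y). lra. }
  (* The two subtracted constants cancel: [w * (- i h) + i * (h * w) = 0]. *)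
  replace (plus v1 (scal (Ci : C_AbsRing) v2)) with
    (plus (minus v1 (scal (RtoC (a + w - a) : C_AbsRing) (scal ((0, - h) : C_AbsRing) D)))
      (scal (Ci : C_AbsRing) (minus v2 (scal (RtoC (c + h - c) : C_AbsRing) (scal ((w, 0) : C_AbsRing) D))))).
  2:{ vring_goals V; unfold Cplus, Cminus, Copp, Cmult; simpl; apply injective_projections; simpl; ring. }
  eapply Rle_trans; [apply @norm_triangle|].
  assert (E : norm (scal (Ci : C_AbsRing) (minus v2 (scal (RtoC (c + h - c) : C_AbsRing) (scal ((w, 0) : C_AbsRing) D))))
     <= (c + h - c) * (eps * (w + h))).
  { eapply Rle_trans; [apply @norm_scal|].
    replace (abs (Ci : C_AbsRing)) with 1.
    - rewrite Rmult_1_l. exact J2.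
    - change (1 = Cmod Ci). unfold Cmod, Ci; simpl. replace (0 * (0 * 1) + 1 * (1 * 1)) with 1 by ring.
      now rewrite sqrt_1. }
  eapply Rle_trans; [apply Rplus_le_compat; [exact J1|exact E]|].
  right; ring.
Qed.

Lemma goursat a c w h : 0 <= w -> 0 <= h ->
  (forall s t, a <= s <= a + w -> c <= t <= c + h -> log_derivable F s t) ->
  boundary_integral a c w h = zero.
Proof.
  intros Hw Hh H. apply (@norm_eq_zero _ V). apply Rle_antisym; [|apply @norm_ge_0].
  apply le_epsilon. intros eps He. rewrite Rplus_0_l.
  (* The bound [e * (w + h)^2] is inherited from the quarters because four times the square of half
     the size is the square of the size. The [+ 1] covers degenerate rectangles. *)
  pose (e := eps / ((w + h) ^ 2 + 1)).
  assert (Hp : 0 <= (w + h) ^ 2) by apply pow2_ge_0.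
  assert (He' : 0 < e) by (apply Rdiv_lt_0_compat; lra).
  apply Rle_trans with (e * (w + h) ^ 2).
  - apply (rectangle_bisection (fun a c w h => norm (boundary_integral a c w h) <= e * (w + h) ^ 2)); trivial.
    + intros a' c' w' h' H1 H2 H3 H4. rewrite boundary_integral_quarters.
      eapply Rle_trans; [apply @norm_triangle|].
      eapply Rle_trans; [apply Rplus_le_compat; apply @norm_triangle|].
      replace (e * (w' + h') ^ 2) with (4 * (e * (w' / 2 + h' / 2) ^ 2)) by field.
      lra.
    + intros s t Hs Ht. apply boundary_integral_small; auto.
  - unfold e. apply Rmult_le_reg_r with ((w + h) ^ 2 + 1); [lra|].
    replace (eps / ((w + h) ^ 2 + 1) * (w + h) ^ 2 * ((w + h) ^ 2 + 1)) with (eps * (w + h) ^ 2)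
      by (field; lra).
    nra.
Qed.
End Goursat.

(** * Cauchy's theorem on the annulus *)

Lemma Cmod_le_Rabs (z : C) : Cmod z <= Rabs (fst z) + Rabs (snd z).
Proof.
  destruct z as [x y]. simpl. replace ((x, y) : C) with (Cplus (RtoC x) (Cmult Ci (RtoC y))).
  - eapply Rle_trans; [apply Cmod_triangle|]. rewrite Cmod_mult, !Cmod_R.
    replace (Cmod Ci) with 1; [lra|]. unfold Cmod, Ci; simpl.
    replace (0 * (0 * 1) + 1 * (1 * 1)) with 1 by ring. now rewrite sqrt_1.
  - unfold Cplus, Cmult, Ci, RtoC; simpl. f_equal; ring.
Qed.

(** [circle_point s t] is [exp (s + i t)]; this is the addition law, from which powers, inverses and
    derivatives on the circles follow. *)
Lemma circle_point_plus s s' t t' :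
  circle_point (s + s') (t + t') = Cmult (circle_point s t) (circle_point s' t').
Proof.
  unfold circle_point, Cmult; simpl. rewrite exp_plus, cos_plus, sin_plus.
  f_equal; ring.
Qed.

Lemma Cmod_circle_point s t : Cmod (circle_point s t) = exp s.
Proof.
  unfold Cmod, circle_point; simpl.
  replace (exp s * cos t * (exp s * cos t * 1) + exp s * sin t * (exp s * sin t * 1))
    with (exp s * exp s * (Rsqr (sin t) + Rsqr (cos t))) by (unfold Rsqr; ring).
  rewrite sin2_cos2, Rmult_1_r. apply sqrt_square. left; apply exp_pos.
Qed.

Lemma circle_point_0 s : circle_point s 0 = RtoC (exp s).
Proof. unfold circle_point. rewrite cos_0, sin_0. unfold RtoC. f_equal; ring. Qed.

Lemma circle_point_2PI s : circle_point s (2 * PI) = circle_point s 0.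
Proof. unfold circle_point. now rewrite cos_2PI, sin_2PI, cos_0, sin_0. Qed.

Lemma derive_eps {V : NormedModule C_AbsRing} (f : C_AbsRing -> V) z D :
  is_derive f z D -> forall eps, 0 < eps -> exists d, 0 < d /\ forall y, Cmod (Cminus y z) < d ->
    norm (minus (minus (f y) (f z)) (scal (Cminus y z : C_AbsRing) D)) <= eps * Cmod (Cminus y z).
Proof.
  intros [_ H] eps He.
  destruct (H z (fun P H => H) (mkposreal eps He)) as [d Hd].
  exists d. split; [apply cond_pos|]. exact Hd.
Qed.

Lemma real_derive_eps (f : R -> R) x l : is_derive f x l ->
  forall eps, 0 < eps -> exists d, 0 < d /\ forall y, Rabs (y - x) < d ->
    Rabs (f y - f x - (y - x) * l) <= eps * Rabs (y - x).
Proof.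
  intros [_ H] eps He.
  destruct (H x (fun P H => H) (mkposreal eps He)) as [d Hd].
  exists d. split; [apply cond_pos|]. exact Hd.
Qed.

Lemma circle_point_near_1 eps : 0 < eps -> exists d, 0 < d /\ forall x y,
  Rabs x < d -> Rabs y < d ->
  Cmod (Cminus (Cminus (circle_point x y) 1) (x, y)) <= eps * (Rabs x + Rabs y).
Proof.
  (* The real and imaginary errors add up to at most [e |x| + 8 e |y|], which [eps / 10] absorbs;
     [e <= 1] gives [exp x <= 3]. *)
  intros He. pose (e := Rmin (eps / 10) 1).
  assert (e0 : 0 < e) by (apply Rmin_glb_lt; lra).
  assert (e1 : e <= 1) by apply Rmin_r.
  assert (e2 : e <= eps / 10) by apply Rmin_l.
  destruct (real_derive_eps exp 0 (exp 0) (is_derive_exp 0) e e0) as (d1 & Hd1 & K1).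
  destruct (real_derive_eps sin 0 (cos 0) (is_derive_sin 0) e e0) as (d2 & Hd2 & K2).
  destruct (real_derive_eps cos 0 (- sin 0) (is_derive_cos 0) e e0) as (d3 & Hd3 & K3).
  exists (Rmin (Rmin d1 e) (Rmin d2 d3)). split; [repeat apply Rmin_glb_lt; lra|].
  intros x y Hx Hy.
  apply Rmin_Rgt_l in Hx; destruct Hx as [Hx _]; apply Rmin_Rgt_l in Hx; destruct Hx as [Hx Hx'].
  apply Rmin_Rgt_l in Hy; destruct Hy as [_ Hy]; apply Rmin_Rgt_l in Hy; destruct Hy as [Hy Hy'].
  specialize (K1 x). specialize (K2 y). specialize (K3 y).
  rewrite ?exp_0, ?sin_0, ?cos_0, ?Rminus_0_r in *.
  specialize (K1 Hx). specialize (K2 Hy). specialize (K3 Hy').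
  eapply Rle_trans; [apply Cmod_le_Rabs|]. simpl.
  pose proof (Rabs_pos x) as px. pose proof (Rabs_pos y) as py.
  set (u := exp x - 1 - x * 1) in K1. set (v := cos y - 1 - y * - 0) in K3.
  set (w := sin y - y * 1) in K2.
  assert (X : Rabs (exp x) <= 3).
  { replace (exp x) with (u + x + 1) by (unfold u; ring).
    eapply Rle_trans; [apply Rabs_triang|]. rewrite Rabs_R1.
    pose proof (Rabs_triang u x). nra. }
  assert (Y : Rabs (exp x - 1) <= 2 * e).
  { replace (exp x - 1) with (u + x) by (unfold u; ring).
    eapply Rle_trans; [apply Rabs_triang|]. nra. }
  assert (A1 : Rabs (exp x * cos y + - (1) + - x) <= e * Rabs x + 3 * (e * Rabs y)).
  { replace (exp x * cos y + - (1) + - x) with (u + exp x * v) by (unfold u, v; ring).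
    eapply Rle_trans; [apply Rabs_triang|]. rewrite Rabs_mult.
    apply Rplus_le_compat; [exact K1|].
    apply Rmult_le_compat; trivial; apply Rabs_pos. }
  assert (A2 : Rabs (exp x * sin y + - 0 + - y) <= 3 * (e * Rabs y) + 2 * e * Rabs y).
  { replace (exp x * sin y + - 0 + - y) with (exp x * w + (exp x - 1) * y) by (unfold w; ring).
    eapply Rle_trans; [apply Rabs_triang|]. rewrite !Rabs_mult.
    apply Rplus_le_compat; apply Rmult_le_compat; trivial; try apply Rabs_pos; lra. }
  eapply Rle_trans; [apply Rplus_le_compat; [exact A1|exact A2]|].
  nra.
Qed.

(** By the addition law the expansion at an arbitrary point is the expansion at the origin
    multiplied by [circle_point s t], whose modulus is [exp s]. *)
Lemma circle_point_differentiable s t eps : 0 < eps -> exists d, 0 < d /\ forall s' t',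
  Rabs (s' - s) < d -> Rabs (t' - t) < d ->
  Cmod (Cminus (Cminus (circle_point s' t') (circle_point s t))
               (Cmult (circle_point s t) (s' - s, t' - t)))
    <= eps * (Rabs (s' - s) + Rabs (t' - t)).
Proof.
  intros He. pose proof (exp_pos s) as Hs.
  destruct (circle_point_near_1 (eps / exp s)) as (d & Hd & K).
  { now apply Rdiv_lt_0_compat. }
  exists d. split; trivial. intros s' t' H1 H2. specialize (K _ _ H1 H2).
  replace (circle_point s' t') with (Cmult (circle_point s t) (circle_point (s' - s) (t' - t))).
  2:{ rewrite <- circle_point_plus. f_equal; ring. }
  replace (Cminus _ _) with (Cmult (circle_point s t)
    (Cminus (Cminus (circle_point (s' - s) (t' - t)) 1) (s' - s, t' - t))) by ring.
  rewrite Cmod_mult, Cmod_circle_point.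
  apply Rmult_le_compat_l with (r := exp s) in K; [|lra].
  eapply Rle_trans; [exact K|]. right. field. lra.
Qed.

Lemma circle_point_lipschitz s t : exists d, 0 < d /\ forall s' t',
  Rabs (s' - s) < d -> Rabs (t' - t) < d ->
  Cmod (Cminus (circle_point s' t') (circle_point s t))
    <= 2 * exp s * (Rabs (s' - s) + Rabs (t' - t)).
Proof.
  pose proof (exp_pos s) as Hs.
  destruct (circle_point_differentiable s t (exp s) Hs) as (d & Hd & K).
  exists d. split; trivial. intros s' t' H1 H2. specialize (K s' t' H1 H2).
  set (A := Cminus (circle_point s' t') (circle_point s t)) in *.
  set (B := Cmult (circle_point s t) (s' - s, t' - t)) in *.
  replace A with (Cplus (Cminus A B) B) by ring.
  eapply Rle_trans; [apply Cmod_triangle|].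
  assert (HB : Cmod B <= exp s * (Rabs (s' - s) + Rabs (t' - t))).
  { unfold B. rewrite Cmod_mult, Cmod_circle_point. apply Rmult_le_compat_l; [lra|].
    apply (Cmod_le_Rabs (s' - s, t' - t)). }
  lra.
Qed.

Lemma circle_point_continuous s t eps : 0 < eps -> exists d, 0 < d /\ forall s' t',
  Rabs (s' - s) < d -> Rabs (t' - t) < d ->
  Cmod (Cminus (circle_point s' t') (circle_point s t)) < eps.
Proof.
  intros He. pose proof (exp_pos s) as Hs.
  destruct (circle_point_lipschitz s t) as (d & Hd & K).
  assert (H : 0 < eps / (4 * exp s)) by (apply Rdiv_lt_0_compat; lra).
  exists (Rmin d (eps / (4 * exp s))). split; [now apply Rmin_glb_lt|].
  intros s' t' H1 H2. apply Rmin_Rgt_l in H1, H2.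
  eapply Rle_lt_trans; [apply K; apply H1 || apply H2|].
  destruct H1 as [_ H1], H2 as [_ H2].
  assert (E : eps = 2 * exp s * (eps / (4 * exp s) + eps / (4 * exp s))) by (field; lra).
  rewrite E. apply Rmult_lt_compat_l; lra.
Qed.

Lemma continuous_on_eps {V : NormedModule C_AbsRing} (D : C_AbsRing -> Prop)
  (f : C_AbsRing -> V) :
  continuous_on D f <-> forall z, D z -> forall eps, 0 < eps -> exists d, 0 < d /\
    forall y, D y -> Cmod (Cminus y z) < d -> norm (minus (f y) (f z)) < eps.
Proof.
  split.
  - intros H z Hz eps He.
    destruct (proj1 (filterlim_locally_ball_norm _ _) (H z Hz) (mkposreal eps He)) as [d Hd].
    exists d. split; [apply cond_pos|]. intros y Hy Hyz. apply (Hd y Hyz Hy).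
  - intros H z Hz. apply filterlim_locally_ball_norm. intros eps.
    destruct (H z Hz eps (cond_pos eps)) as (d & Hd & K).
    exists (mkposreal d Hd). intros y Hy HD. apply K; trivial.
Qed.

(** Compactness of [[a, b]] for any statement [Q t d] that survives shrinking [d]. Continuity
    uniform in a parameter, uniform chord estimates and boundedness are all obtained as
    instances. *)
Lemma tube (a b : R) (Q : R -> R -> Prop) :
  (forall t d d', 0 < d' <= d -> Q t d -> Q t d') ->
  (forall t, a <= t <= b -> exists d, 0 < d /\ forall t', Rabs (t' - t) < d -> Q t' d) ->
  exists d, 0 < d /\ forall t, a <= t <= b -> Q t d.
Proof.
  intros Hm Hl.
  assert (K : forall t, exists d : posreal, a <= t <= b -> forall t', Rabs (t' - t) < d -> Q t' d).
  { intros t. destruct (classic (a <= t <= b)) as [H|H].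
    - destruct (Hl t H) as (d & Hd & HQ). now exists (mkposreal d Hd).
    - exists (mkposreal 1 Rlt_0_1). tauto. }
  destruct (choice _ K) as [delta Hdelta].
  destruct (compactness_value_1d a b delta) as [d Hd].
  exists d. split; [apply cond_pos|]. intros t Ht.
  destruct (NNPP _ (Hd t Ht)) as (u & Hu & H1 & H2).
  apply Hm with (delta u); [split; [apply cond_pos|exact H2]|].
  now apply Hdelta.
Qed.

(* Clamping makes the log-polar form of a function on the annulus continuous on the
   whole plane, so that all integrals below exist. *)
Definition clamp (s : R) : R := Rmax 0 (Rmin 1 s).

Lemma clamp_bounds s : 0 <= clamp s <= 1.
Proof. unfold clamp. unfold Rmin. destruct Rle_dec; unfold Rmax; destruct Rle_dec; lra. Qed.
Lemma clamp_id s : 0 <= s <= 1 -> clamp s = s.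
Proof. unfold clamp. unfold Rmin. destruct Rle_dec; unfold Rmax; destruct Rle_dec; lra. Qed.
Lemma clamp_lipschitz s s' : Rabs (clamp s' - clamp s) <= Rabs (s' - s).
Proof.
  unfold clamp, Rmin. destruct (Rle_dec 1 s), (Rle_dec 1 s'); unfold Rmax;
    repeat destruct Rle_dec; unfold Rabs; repeat destruct Rcase_abs; lra.
Qed.

Lemma exp_monotone x y : x <= y -> exp x <= exp y.
Proof. intros [H|<-]; [left; now apply exp_increasing | apply Rle_refl]. Qed.

Lemma annulus_circle_point s t : 0 <= s <= 1 -> annulus (circle_point s t).
Proof.
  intros Hs. unfold annulus. rewrite Cmod_circle_point.
  split; [rewrite <- exp_0|]; apply exp_monotone; apply Hs.
Qed.

Section AnnulusCauchy.
Context {V : CompleteNormedModule C_AbsRing}.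
Variable k : C_AbsRing -> V.
Variable theta : R.
Hypothesis Htheta : 0 < theta < 1.
Hypothesis Hcont : continuous_on annulus k.
Hypothesis Hderiv : forall z, annulus_interior z -> z <> RtoC (exp theta) -> ex_derive k z.

Let F (s t : R) : V := k (circle_point (clamp s) t).

Lemma log_polar_continuous : jointly_continuous F.
Proof.
  intros s t eps He.
  destruct (proj1 (@continuous_on_eps V annulus k) Hcont (circle_point (clamp s) t)
    (annulus_circle_point _ _ (clamp_bounds s)) eps He) as (d & Hd & K).
  destruct (circle_point_continuous (clamp s) t d Hd) as (d' & Hd' & K').
  exists d'. split; trivial. intros s' t' H1 H2. apply K.
  - apply annulus_circle_point, clamp_bounds.
  - apply K'; trivial. eapply Rle_lt_trans; [apply clamp_lipschitz | exact H1].
Qed.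

Lemma log_polar_derivable s t : 0 < s < 1 -> s <> theta -> log_derivable F s t.
Proof.
  intros Hs Hst. set (z := circle_point s t).
  destruct (Hderiv z) as [D HD].
  { unfold annulus_interior, z. rewrite Cmod_circle_point. split.
    - rewrite <- exp_0. now apply exp_increasing.
    - now apply exp_increasing. }
  { intros E. apply Hst. apply exp_inv. apply (f_equal Cmod) in E. unfold z in E.
    rewrite Cmod_circle_point, Cmod_R, Rabs_pos_eq in E; trivial. left; apply exp_pos. }
  (* Chain rule: the derivative of [k (exp (s + i t))] in [s + i t] is [z * k' z]. *)
  exists (scal (z : C_AbsRing) D). intros eps He.
  pose proof (exp_pos s) as Ps. pose proof (norm_ge_0 D) as PD.
  assert (He1 : 0 < eps / (4 * exp s)) by (apply Rdiv_lt_0_compat; lra).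
  assert (He2 : 0 < eps / (2 * (norm D + 1))) by (apply Rdiv_lt_0_compat; lra).
  destruct (@derive_eps V _ _ _ HD _ He1) as (d1 & Hd1 & K1).
  destruct (circle_point_continuous s t d1 Hd1) as (d2 & Hd2 & K2).
  destruct (circle_point_differentiable s t _ He2) as (d3 & Hd3 & K3).
  destruct (circle_point_lipschitz s t) as (d4 & Hd4 & K4).
  (* The bounds [s] and [1 - s] keep [s'] in [[0, 1]], where [clamp] acts as the identity. *)
  pose (d := Rmin (Rmin d2 d3) (Rmin d4 (Rmin s (1 - s)))).
  exists d. split; [unfold d; repeat apply Rmin_glb_lt; lra|].
  intros s' t' H1 H2.
  assert (d <= d2 /\ d <= d3 /\ d <= d4 /\ d <= s /\ d <= 1 - s) as (L2 & L3 & L4 & L5 & L6).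
  { unfold d.
    pose proof (Rmin_l (Rmin d2 d3) (Rmin d4 (Rmin s (1 - s)))).
    pose proof (Rmin_r (Rmin d2 d3) (Rmin d4 (Rmin s (1 - s)))).
    pose proof (Rmin_l d2 d3). pose proof (Rmin_r d2 d3).
    pose proof (Rmin_l d4 (Rmin s (1 - s))). pose proof (Rmin_r d4 (Rmin s (1 - s))).
    pose proof (Rmin_l s (1 - s)). pose proof (Rmin_r s (1 - s)). lra. }
  assert (Hs' : 0 <= s' <= 1) by (apply Rabs_lt_between' in H1; lra).
  unfold F. rewrite !clamp_id by lra. fold z.
  specialize (K2 s' t' ltac:(lra) ltac:(lra)). specialize (K3 s' t' ltac:(lra) ltac:(lra)).
  specialize (K4 s' t' ltac:(lra) ltac:(lra)).
  set (z' := circle_point s' t') in *. fold z in K2, K3, K4. specialize (K1 z' K2).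
  set (X := Rabs (s' - s) + Rabs (t' - t)) in *.
  match goal with |- norm ?x <= _ => replace x with
    (plus (minus (minus (k z') (k z)) (scal (Cminus z' z : C_AbsRing) D))
       (scal (Cminus (Cminus z' z) (Cmult z (s' - s, t' - t)) : C_AbsRing) D)) end.
  2:{ vring V. }
  eapply Rle_trans; [apply @norm_triangle|].
  assert (B2 : norm (scal (Cminus (Cminus z' z) (Cmult z (s' - s, t' - t)) : C_AbsRing) D)
     <= eps / (2 * (norm D + 1)) * X * norm D).
  { eapply Rle_trans; [apply @norm_scal|]. apply Rmult_le_compat_r; trivial. }
  assert (PX : 0 <= X).
  { unfold X. pose proof (Rabs_pos (s' - s)). pose proof (Rabs_pos (t' - t)). lra. }
  assert (B1 : eps / (4 * exp s) * Cmod (Cminus z' z) <= eps / 2 * X).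
  { replace (eps / 2 * X) with (eps / (4 * exp s) * (2 * exp s * X)) by (field; lra).
    apply Rmult_le_compat_l; lra. }
  assert (B3 : eps / (2 * (norm D + 1)) * X * norm D <= eps / 2 * X).
  { replace (eps / 2 * X) with (eps / (2 * (norm D + 1)) * X * (norm D + 1)) by (field; lra).
    apply Rmult_le_compat_l; [|lra]. apply Rmult_le_pos; lra. }
  eapply Rle_trans; [apply Rplus_le_compat; [exact K1|exact B2]|]. lra.
Qed.

Let m (s : R) : V := integral (F s) 0 (2 * PI).

(** Goursat on [[s1, s2] x [0, 2 PI]]: the horizontal sides coincide by periodicity and cancel,
    leaving [i (m s2 - m s1) = 0]. The rectangle must avoid the line [s = theta], which contains the
    exceptional point. *)
Lemma circle_integral_locally_constant s1 s2 : 0 < s1 <= s2 -> s2 < 1 ->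
  (s2 < theta \/ theta < s1) -> m s1 = m s2.
Proof.
  intros H1 H2 Ht.
  assert (G := goursat F log_polar_continuous s1 0 (s2 - s1) (2 * PI) ltac:(lra)
    ltac:(pose proof PI_RGT_0; lra)).
  unfold boundary_integral in G.
  replace (s1 + (s2 - s1)) with s2 in G by ring. rewrite Rplus_0_l in G.
  replace (fun s => F s (2 * PI)) with (fun s => F s 0) in G.
  2:{ apply FunctionalExtensionality.functional_extensionality. intros s. unfold F.
      now rewrite circle_point_2PI. }
  change (integral (fun t => F s1 t) 0 (2 * PI)) with (m s1) in G.
  change (integral (fun t => F s2 t) 0 (2 * PI)) with (m s2) in G.
  assert (E : scal (Ci : C_AbsRing) (minus (m s2) (m s1)) = zero).
  { etransitivity; [|apply G; intros s t Hs _; apply log_polar_derivable; lra]. vring V. }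
  (* Here [i * i = -1] replaces a division by [i]. *)
  replace (m s1) with (plus (m s2) (scal (Ci : C_AbsRing) (scal (Ci : C_AbsRing) (minus (m s2) (m s1))))).
  - rewrite E. vring V.
  - vring_goals V; unfold Ci, Cplus, Cmult, Cminus, RtoC, Copp; simpl; f_equal; ring.
Qed.

Lemma circle_integral_continuous s0 eps : 0 < eps -> exists d, 0 < d /\
  forall s, Rabs (s - s0) < d -> norm (minus (m s) (m s0)) <= eps.
Proof.
  intros He. pose proof PI_RGT_0 as HPI.
  assert (He' : 0 < eps / (2 * PI)) by (apply Rdiv_lt_0_compat; lra).
  destruct (tube 0 (2 * PI) (fun t d => forall s, Rabs (s - s0) < d ->
     norm (minus (F s t) (F s0 t)) <= eps / (2 * PI))) as (d & Hd & K).
  - intros t d d' Hd K s Hs. apply K. lra.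
  - intros t _. destruct (log_polar_continuous s0 t (eps / (2 * PI) / 2)) as (d & Hd & K); [lra|].
    exists d. split; trivial. intros t' Ht' s Hs.
    replace (minus (F s t') (F s0 t')) with
      (minus (minus (F s t') (F s0 t)) (minus (F s0 t') (F s0 t))) by vring V.
    eapply Rle_trans; [apply norm_minus_le|].
    pose proof (K s t' Hs Ht') as K1. pose proof (K s0 t') as K2.
    rewrite Rminus_diag, Rabs_R0 in K2. specialize (K2 Hd Ht').
    eapply Rle_trans; [apply Rplus_le_compat; left; [exact K1 | exact K2]|]. lra.
  - exists d. split; trivial. intros s Hs.
    replace eps with ((2 * PI - 0) * (eps / (2 * PI))) by (field; lra).
    assert (I : forall s, is_integral (F s) 0 (2 * PI) (m s)).
    { intros. apply is_integral_integral. apply (jointly_continuous_r F log_polar_continuous). }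
    pose proof (is_integral_minus _ _ _ _ _ _ (I s) (I s0)) as J.
    eapply is_integral_bound; [|intros t Ht; apply (K t Ht s Hs)|exact J|].
    + lra.
    + apply (@is_RInt_const R_NormedModule).
Qed.

(* The possible singularity at [e^theta] is avoided: the circle integral is constant for
   [0 < s < theta] and for [theta < s < 1], and continuous at [0], [theta] and [1]. *)
Theorem annulus_circle_integrals_eq :
  integral (fun t => k (circle_point 0 t)) 0 (2 * PI) =
  integral (fun t => k (circle_point 1 t)) 0 (2 * PI).
Proof.
  replace (integral (fun t => k (circle_point 0 t)) 0 (2 * PI)) with (m 0).
  2:{ unfold m, F. now rewrite clamp_id by lra. }
  replace (integral (fun t => k (circle_point 1 t)) 0 (2 * PI)) with (m 1).
  2:{ unfold m, F. now rewrite clamp_id by lra. }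
  assert (Z : norm (minus (m 0) (m 1)) = 0).
  { apply Rle_antisym; [|apply @norm_ge_0]. apply le_epsilon. intros eps He. rewrite Rplus_0_l.
    destruct (circle_integral_continuous 0 (eps / 4)) as (d0 & Hd0 & K0); [lra|].
    destruct (circle_integral_continuous theta (eps / 4)) as (d1 & Hd1 & K1); [lra|].
    destruct (circle_integral_continuous 1 (eps / 4)) as (d2 & Hd2 & K2); [lra|].
    (* The halving makes [d] strictly smaller than the three radii and ensures [d <= theta - d] and
       [theta + d <= 1 - d]. *)
    pose (d := Rmin (Rmin d0 (Rmin d1 d2)) (Rmin theta (1 - theta)) / 2).
    assert (0 < d /\ d < d0 /\ d < d1 /\ d < d2 /\ d <= theta / 2 /\ d <= (1 - theta) / 2)
      as (D & D0 & D1 & D2 & D3 & D4).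
    { unfold d.
      pose proof (Rmin_l (Rmin d0 (Rmin d1 d2)) (Rmin theta (1 - theta))).
      pose proof (Rmin_r (Rmin d0 (Rmin d1 d2)) (Rmin theta (1 - theta))).
      pose proof (Rmin_l d0 (Rmin d1 d2)). pose proof (Rmin_r d0 (Rmin d1 d2)).
      pose proof (Rmin_l d1 d2). pose proof (Rmin_r d1 d2).
      pose proof (Rmin_l theta (1 - theta)). pose proof (Rmin_r theta (1 - theta)).
      assert (0 < Rmin (Rmin d0 (Rmin d1 d2)) (Rmin theta (1 - theta)))
        by (repeat apply Rmin_glb_lt; lra).
      lra. }
    specialize (K0 d). rewrite Rabs_pos_eq in K0 by lra. specialize (K0 ltac:(lra)).
    pose proof (K1 (theta - d)) as K1a. rewrite Rabs_left in K1a by lra. specialize (K1a ltac:(lra)).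
    pose proof (K1 (theta + d)) as K1b. rewrite Rabs_pos_eq in K1b by lra. specialize (K1b ltac:(lra)).
    specialize (K2 (1 - d)). rewrite Rabs_left in K2 by lra. specialize (K2 ltac:(lra)).
    (* Four errors of [eps / 4]: from [m 0] to [m d = m (theta - d)], to [m theta], to
       [m (theta + d) = m (1 - d)], to [m 1]. *)
    rewrite (circle_integral_locally_constant d (theta - d)) in K0 by lra.
    rewrite <- (circle_integral_locally_constant (theta + d) (1 - d)) in K2 by lra.
    replace (minus (m 0) (m 1)) with
      (plus (minus (minus (m (theta - d)) (m theta)) (minus (m (theta - d)) (m 0)))
            (minus (minus (m (theta + d)) (m 1)) (minus (m (theta + d)) (m theta)))) by vring V.
    eapply Rle_trans; [apply @norm_triangle|].
    eapply Rle_trans; [apply Rplus_le_compat; apply norm_minus_le|]. lra. }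
  apply (@norm_eq_zero _ V) in Z.
  replace (m 0) with (plus (m 1) (minus (m 0) (m 1))) by vring V. rewrite Z. vring V.
Qed.
End AnnulusCauchy.

(** * Fejer means *)

Definition double_sum {G : AbelianMonoid} (f : nat -> nat -> G) (N : nat) : G :=
  sum_n (fun k => sum_n (fun l => f k l) N) N.

Lemma double_sum_ext {G : AbelianMonoid} (f g : nat -> nat -> G) N :
  (forall k l, f k l = g k l) -> double_sum f N = double_sum g N.
Proof. intros H. apply sum_n_ext; intros k. apply sum_n_ext; intros l. apply H. Qed.

Lemma sum_n_additive {G G' : AbelianMonoid} (l : G -> G') (a : nat -> G) N :
  (forall x y, l (plus x y) = plus (l x) (l y)) ->
  l (sum_n a N) = sum_n (fun k => l (a k)) N.
Proof.
  intros H. induction N as [|N IH]; [now rewrite !sum_O|]. now rewrite !sum_Sn, H, IH.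
Qed.

Lemma double_sum_additive {G G' : AbelianMonoid} (l : G -> G') (a : nat -> nat -> G) N :
  (forall x y, l (plus x y) = plus (l x) (l y)) ->
  l (double_sum a N) = double_sum (fun i j => l (a i j)) N.
Proof.
  intros H. unfold double_sum. rewrite sum_n_additive by exact H.
  apply sum_n_ext; intros k. now apply sum_n_additive.
Qed.

Lemma sum_n_kronecker (c : R) k N :
  sum_n (fun l => if Nat.eq_dec k l then c else 0) N = if le_dec k N then c else 0.
Proof.
  induction N as [|N IH].
  - rewrite sum_O. destruct Nat.eq_dec, le_dec; trivial; lia.
  - rewrite sum_Sn, IH. unfold plus; simpl.
    destruct Nat.eq_dec, (le_dec k N), (le_dec k (S N)); try lia; ring.
Qed.

Definition dirichlet (N : nat) (x : R) : C_AbsRing := sum_n (fun k => circle_point 0 (INR k * x)) N.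
(** This is [N + 1] times the usual Fejer kernel. As the squared modulus of a one-sided exponential
    sum it is visibly nonnegative, and expanding the square gives the double sum that defines the
    means. *)
Definition fejer_kernel (N : nat) (x : R) : R := Cmod (dirichlet N x) ^ 2.

Lemma Cconj_circle_point t : Cconj (circle_point 0 t) = circle_point 0 (- t).
Proof. unfold Cconj, circle_point; simpl. rewrite cos_neg, sin_neg. f_equal; ring. Qed.

Lemma fejer_kernel_double_sum N x :
  RtoC (fejer_kernel N x) =
  double_sum (fun k l => circle_point 0 ((INR k - INR l) * x) : C_AbsRing) N.
Proof.
  unfold fejer_kernel. rewrite Cmod2_conj. unfold dirichlet at 2.
  rewrite (sum_n_additive (Cconj : C_AbsRing -> C_AbsRing)) by apply Cplus_conj.
  set (S := dirichlet N x). unfold double_sum.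
  transitivity (sum_n (fun k => mult (circle_point 0 (INR k * x) : C_AbsRing)
     (sum_n (fun l => Cconj (circle_point 0 (INR l * x)) : C_AbsRing) N)) N).
  - symmetry. apply (@sum_n_mult_r C_AbsRing).
  - apply sum_n_ext; intros k. etransitivity; [symmetry; apply (@sum_n_mult_l C_AbsRing)|].
    apply sum_n_ext; intros l. rewrite Cconj_circle_point.
    change (Cmult (circle_point 0 (INR k * x)) (circle_point 0 (- (INR l * x))) =
      circle_point 0 ((INR k - INR l) * x)).
    rewrite <- circle_point_plus. f_equal; ring.
Qed.

Lemma dirichlet_telescope N x :
  Cmult (dirichlet N x) (Cminus 1 (circle_point 0 x)) =
  Cminus 1 (circle_point 0 (INR (S N) * x)).
Proof.
  unfold dirichlet. induction N as [|N IH].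
  - rewrite sum_O. simpl INR. rewrite Rmult_0_l, Rmult_1_l, circle_point_0, exp_0. ring.
  - rewrite sum_Sn.
    change (Cmult (Cplus (sum_n (fun k => circle_point 0 (INR k * x) : C_AbsRing) N)
      (circle_point 0 (INR (S N) * x))) (Cminus 1 (circle_point 0 x)) =
      Cminus 1 (circle_point 0 (INR (S (S N)) * x))).
    rewrite Cmult_plus_distr_r, IH.
    replace (circle_point 0 (INR (S (S N)) * x)) with
      (Cmult (circle_point 0 (INR (S N) * x)) (circle_point 0 x)).
    + ring.
    + rewrite <- circle_point_plus. rewrite (S_INR (S N)). f_equal; ring.
Qed.

Lemma fejer_kernel_ge_0 N x : 0 <= fejer_kernel N x.
Proof. apply pow2_ge_0. Qed.

(** The geometric sum has modulus at most [2 / |1 - e^(ix)|]. The bound does not involve [N], so it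
    vanishes after division by [N + 1]. *)
Lemma fejer_kernel_off_diagonal N x d : 0 < d -> d <= Cmod (Cminus 1 (circle_point 0 x)) ->
  fejer_kernel N x <= 4 / d ^ 2.
Proof.
  intros Hd H. assert (E := f_equal Cmod (dirichlet_telescope N x)). rewrite Cmod_mult in E.
  assert (B : Cmod (Cminus 1 (circle_point 0 (INR (S N) * x))) <= 2).
  { unfold Cminus. eapply Rle_trans; [apply Cmod_triangle|].
    rewrite Cmod_opp, Cmod_circle_point, exp_0, Cmod_1. lra. }
  rewrite <- E in B. unfold fejer_kernel. set (s := Cmod (dirichlet N x)) in *.
  assert (s0 : 0 <= s) by apply Cmod_ge_0.
  assert (sd : s * d <= 2).
  { eapply Rle_trans; [|exact B]. now apply Rmult_le_compat_l. }
  apply Rmult_le_reg_r with (d ^ 2); [now apply pow_lt|].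
  replace (4 / d ^ 2 * d ^ 2) with (2 ^ 2) by (field; lra).
  rewrite <- Rpow_mult_distr. apply pow_incr. split; trivial. apply Rmult_le_pos; lra.
Qed.

Lemma is_RInt_cos_nat n u : (0 < n)%nat ->
  is_RInt (fun t => cos (INR n * (u - t))) 0 (2 * PI) 0.
Proof.
  intros Hn. assert (Hn' : INR n <> 0) by (apply not_0_INR; lia).
  replace 0 with (minus (- sin (INR n * (u - 2 * PI)) / INR n) (- sin (INR n * (u - 0)) / INR n)) at 2.
  - apply (@is_RInt_derive R_CompleteNormedModule (fun t => - sin (INR n * (u - t)) / INR n)).
    + intros x _. auto_derive; trivial. match goal with |- ?a = ?b => change (@eq R a b) end. unfold Rminus. field. exact Hn'.
    + intros x _. apply (@ex_derive_continuous R_AbsRing R_NormedModule).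
      auto_derive; trivial.
  - assert (E : sin (INR n * (u - 0)) = sin (INR n * (u - 2 * PI))).
    { rewrite <- (sin_period (INR n * (u - 2 * PI)) n). f_equal. ring. }
    rewrite E. apply (@plus_opp_r R_AbelianGroup).
Qed.

Lemma is_RInt_cos k l u :
  is_RInt (fun t => cos ((INR k - INR l) * (u - t))) 0 (2 * PI)
    (if Nat.eq_dec k l then 2 * PI else 0).
Proof.
  destruct Nat.eq_dec as [->|H].
  - apply is_RInt_ext with (fun _ => 1).
    { intros t _. rewrite Rminus_diag, Rmult_0_l, cos_0. trivial. }
    replace (2 * PI) with (scal (2 * PI - 0) 1) at 2.
    + apply (@is_RInt_const R_NormedModule).
    + unfold scal; simpl; unfold mult; simpl; ring.
  - destruct (Nat.lt_ge_cases k l) as [L|L].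
    + apply is_RInt_ext with (fun t => cos (INR (l - k) * (u - t))).
      { intros t _. rewrite minus_INR by lia. rewrite <- cos_neg. f_equal. ring. }
      apply is_RInt_cos_nat. lia.
    + apply is_RInt_ext with (fun t => cos (INR (k - l) * (u - t))).
      { intros t _. rewrite minus_INR by lia. trivial. }
      apply is_RInt_cos_nat. lia.
Qed.

Lemma is_RInt_sum_n (f : nat -> R -> R) a b (v : nat -> R) N :
  (forall k, is_RInt (f k) a b (v k)) ->
  is_RInt (fun t => sum_n (fun k => f k t) N) a b (sum_n v N).
Proof.
  intros H. induction N as [|N IH].
  - rewrite sum_O. eapply is_RInt_ext; [|apply H]. intros; now rewrite sum_O.
  - rewrite sum_Sn. eapply is_RInt_ext; [|apply @is_RInt_plus; [apply IH|apply H]].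
    intros; now rewrite sum_Sn.
Qed.

(** The kernel is real, so its double sum may be replaced by the real parts, which are cosines. Only
    the [N + 1] diagonal terms have a nonzero integral, each equal to [2 PI]. *)
Lemma is_RInt_fejer_kernel N u :
  is_RInt (fun t => fejer_kernel N (u - t)) 0 (2 * PI) (2 * PI * (INR N + 1)).
Proof.
  replace (2 * PI * (INR N + 1)) with
    (double_sum (fun k l => if Nat.eq_dec k l then 2 * PI else 0) N).
  - apply is_RInt_ext with (fun t => double_sum (fun k l => cos ((INR k - INR l) * (u - t))) N).
    + intros t _. change (fejer_kernel N (u - t)) with (fst (RtoC (fejer_kernel N (u - t)))).
      rewrite fejer_kernel_double_sum.
      rewrite (@double_sum_additive C_AbsRing R_AbelianMonoid (fst : C -> R)) by reflexivity.
      apply double_sum_ext. intros k l. unfold circle_point; simpl. rewrite exp_0. ring.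
    + apply is_RInt_sum_n. intros k. apply is_RInt_sum_n. intros l. apply is_RInt_cos.
  - unfold double_sum. transitivity (sum_n (fun _ => 2 * PI) N).
    + apply sum_n_ext_loc. intros k Hk. rewrite sum_n_kronecker.
      destruct le_dec; trivial; contradiction.
    + rewrite sum_n_const, S_INR. match goal with |- ?a = ?b => change (@eq R a b) end. ring.
Qed.

Section FejerMeans.
Context {V : CompleteNormedModule C_AbsRing}.
Variable j : R.
Variable phi : R -> V.
Hypothesis phi_continuous : forall t, continuous phi t.
(* Continuity in terms of chords encodes periodicity, so no integral has to be translated. *)
Hypothesis phi_chord : forall eps, 0 < eps -> exists d, 0 < d /\ forall t u,
  0 <= t <= 2 * PI -> 0 <= u <= 2 * PI ->
  Cmod (Cminus (circle_point j t) (circle_point j u)) < d ->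
  norm (minus (phi t) (phi u)) < eps.

(** The factor is [z^(-n)] at [z = circle_point j t], radius included. The coefficients are thus
    those of a Laurent series in [z], and this normalization makes the two circles comparable. *)
Definition fourier_integral (n : Z) : V :=
  integral (fun t => scal (circle_point (- (IZR n * j)) (- (IZR n * t)) : C_AbsRing) (phi t))
    0 (2 * PI).
Definition fourier_coef (n : Z) : V :=
  scal (RtoC (/ (2 * PI)) : C_AbsRing) (fourier_integral n).

(** The difference [k - l] takes the value [n] for [N + 1 - |n|] pairs, so this is the sum of
    [(1 - |n| / (N + 1)) c_n z^n], with the Cesaro weights expressed by counting. *)
Definition fejer_mean (N : nat) (u : R) : V :=
  scal (RtoC (/ (INR N + 1)) : C_AbsRing)
    (double_sum (fun k l => let n := (Z.of_nat k - Z.of_nat l)%Z in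
       scal (circle_point (IZR n * j) (IZR n * u) : C_AbsRing) (fourier_coef n)) N).

Lemma continuous_circle_point_scal (a b c : R) (f : R -> V) (t : R) :
  continuous f t -> continuous (fun t => scal (circle_point a (b * t) : C_AbsRing) (f t)) t.
Proof.
  intros Hf. apply (@continuous_eps V). intros eps He.
  pose proof (norm_ge_0 (f t)) as P. pose proof (exp_pos a) as Pa.
  (* The [+ 1] keeps the denominator positive when [f t] vanishes; the same device is used for [b]
     below. *)
  assert (He1 : 0 < eps / (2 * (norm (f t) + 1))) by (apply Rdiv_lt_0_compat; lra).
  assert (He2 : 0 < eps / (2 * exp a)) by (apply Rdiv_lt_0_compat; lra).
  destruct (circle_point_continuous a (b * t) _ He1) as (d1 & Hd1 & K1).
  destruct (proj1 (filterlim_locally_ball_norm _ _) Hf (mkposreal _ He2)) as [d2 K2].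
  pose proof (Rabs_pos b) as Pb. pose proof (cond_pos d2) as Hd2.
  assert (Hd3 : 0 < d1 / (Rabs b + 1)) by (apply Rdiv_lt_0_compat; lra).
  exists (Rmin (d1 / (Rabs b + 1)) d2). split; [now apply Rmin_glb_lt|].
  intros t' Ht. apply Rmin_Rgt_l in Ht. destruct Ht as [Ht1 Ht2].
  specialize (K2 t' Ht2). unfold ball_norm in K2. simpl in K2.
  specialize (K1 a (b * t')). rewrite Rminus_diag, Rabs_R0 in K1. specialize (K1 Hd1).
  replace (b * t' - b * t) with (b * (t' - t)) in K1 by ring. rewrite Rabs_mult in K1.
  assert (K1' : Rabs b * Rabs (t' - t) < d1).
  { apply Rle_lt_trans with ((Rabs b + 1) * Rabs (t' - t)).
    - apply Rmult_le_compat_r; [apply Rabs_pos|lra].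
    - apply Rmult_lt_compat_l with (r := Rabs b + 1) in Ht1; [|lra].
      replace ((Rabs b + 1) * (d1 / (Rabs b + 1))) with d1 in Ht1 by (field; lra). exact Ht1. }
  specialize (K1 K1').
  replace (minus _ _) with (plus (scal (circle_point a (b * t') : C_AbsRing) (minus (f t') (f t)))
    (scal (Cminus (circle_point a (b * t')) (circle_point a (b * t)) : C_AbsRing) (f t))) by vring V.
  eapply Rle_lt_trans; [apply @norm_triangle|].
  apply Rle_lt_trans with (exp a * norm (minus (f t') (f t)) +
    Cmod (Cminus (circle_point a (b * t')) (circle_point a (b * t))) * norm (f t)).
  { apply Rplus_le_compat.
    - eapply Rle_trans; [apply @norm_scal|]. right. f_equal. apply Cmod_circle_point.
    - apply @norm_scal. }
  apply Rlt_le_trans with (exp a * (eps / (2 * exp a)) + eps / (2 * (norm (f t) + 1)) * (norm (f t) + 1)).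
  - apply Rplus_lt_le_compat.
    + apply Rmult_lt_compat_l; trivial.
    + apply Rmult_le_compat; trivial; try lra. apply Cmod_ge_0.
  - right. field. split; lra.
Qed.

Lemma is_integral_fourier n : is_integral
  (fun t => scal (circle_point (- (IZR n * j)) (- (IZR n * t)) : C_AbsRing) (phi t))
  0 (2 * PI) (fourier_integral n).
Proof.
  apply is_integral_integral. intros t.
  eapply continuous_ext; [|apply (continuous_circle_point_scal (- (IZR n * j)) (- IZR n) 0 phi t), phi_continuous].
  intros x. simpl. f_equal. f_equal. ring.
Qed.

(** The radii cancel in [z^n * w^(-n)] for [z], [w] on the same circle, so the kernel depends on
    [u - t] alone and is the same for both circles. *)
Lemma fejer_mean_convolution N u : is_integral
  (fun t => scal (RtoC (fejer_kernel N (u - t)) : C_AbsRing) (phi t)) 0 (2 * PI)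
  (scal (RtoC (2 * PI * (INR N + 1)) : C_AbsRing) (fejer_mean N u)).
Proof.
  pose proof PI_RGT_0 as HPI. pose proof (pos_INR N) as HN.
  replace (scal (RtoC (2 * PI * (INR N + 1)) : C_AbsRing) (fejer_mean N u)) with
    (double_sum (fun k l => let n := (Z.of_nat k - Z.of_nat l)%Z in
       scal (circle_point (IZR n * j) (IZR n * u) : C_AbsRing) (fourier_integral n)) N).
  - apply is_integral_ext with (fun t => double_sum (fun k l =>
      let n := (Z.of_nat k - Z.of_nat l)%Z in
      scal (circle_point (IZR n * j) (IZR n * u) : C_AbsRing)
        (scal (circle_point (- (IZR n * j)) (- (IZR n * t)) : C_AbsRing) (phi t))) N).
    + intros t. rewrite fejer_kernel_double_sum.
      rewrite (double_sum_additive (fun c : C_AbsRing => scal c (phi t))).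
      2:{ intros. apply @scal_distr_r. }
      apply double_sum_ext. intros k l. cbv zeta.
      rewrite minus_IZR, <- !INR_IZR_INZ. etransitivity; [apply @scal_assoc|].
      apply (f_equal (fun c : C_AbsRing => scal c (phi t))).
      change (Cmult (circle_point ((INR k - INR l) * j) ((INR k - INR l) * u))
        (circle_point (- ((INR k - INR l) * j)) (- ((INR k - INR l) * t))) =
        circle_point 0 ((INR k - INR l) * (u - t))).
      rewrite <- circle_point_plus. f_equal; ring.
    + apply is_integral_sum_n. intros k. apply is_integral_sum_n. intros l.
      apply is_integral_scal, is_integral_fourier.
  - unfold fejer_mean.
    rewrite (double_sum_additive (fun v : V => scal (RtoC (/ (INR N + 1)) : C_AbsRing) v)).
    2:{ intros. apply @scal_distr_l. }
    rewrite (double_sum_additive (fun v : V => scal (RtoC (2 * PI * (INR N + 1)) : C_AbsRing) v)).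
    2:{ intros. apply @scal_distr_l. }
    apply double_sum_ext. intros k l. cbv zeta. unfold fourier_coef.
    set (n := (Z.of_nat k - Z.of_nat l)%Z).
    vring_goals V.
    set (c := circle_point _ _).
    replace (Cmult (RtoC (2 * PI * (INR N + 1))) (Cmult (RtoC (/ (INR N + 1)))
       (Cmult c (Cmult (RtoC (/ (2 * PI))) 1)))) with
       (Cmult c (RtoC (2 * PI * (INR N + 1) * / (INR N + 1) * / (2 * PI)))).
    + replace (2 * PI * (INR N + 1) * / (INR N + 1) * / (2 * PI)) with 1 by (field; lra). trivial.
    + rewrite !RtoC_mult. ring.
Qed.

Lemma phi_bounded : exists M, 0 < M /\ forall t, 0 <= t <= 2 * PI -> norm (phi t) <= M.
Proof.
  (* A bound is encoded as the reciprocal of a tolerance, since [tube] needs a statement that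
     survives shrinking [d]. *)
  destruct (tube 0 (2 * PI) (fun t d => norm (phi t) <= / d)) as (d & Hd & K).
  - intros t d d' Hd H. eapply Rle_trans; [exact H|]. apply Rinv_le_contravar; lra.
  - intros t _. pose proof (norm_ge_0 (phi t)) as P.
    destruct (proj1 (filterlim_locally_ball_norm _ _) (phi_continuous t) (mkposreal 1 Rlt_0_1)) as [d K].
    assert (H : 0 < / (norm (phi t) + 1)) by (apply Rinv_0_lt_compat; lra).
    exists (Rmin d (/ (norm (phi t) + 1))). pose proof (cond_pos d).
    split; [now apply Rmin_glb_lt|]. intros t' Ht'. apply Rmin_Rgt_l in Ht'.
    specialize (K t' (proj1 Ht')). unfold ball_norm in K. simpl in K.
    apply Rle_trans with (norm (phi t) + 1).
    + replace (phi t') with (plus (phi t) (minus (phi t') (phi t))) by vring V.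
      eapply Rle_trans; [apply @norm_triangle|]. apply Rplus_le_compat_l. left; exact K.
    + apply Rle_trans with (/ / (norm (phi t) + 1)); [rewrite Rinv_inv; lra|].
      apply Rinv_le_contravar.
      * now apply Rmin_glb_lt.
      * apply Rmin_r.
  - exists (/ d). split; [now apply Rinv_0_lt_compat|]. exact K.
Qed.

(** Approximate identity argument, split by chord length: points near [u] contribute at most
    [eps / 2] by continuity, and far points at most [Q / (N + 1)] after normalization. *)
Theorem fejer_mean_converges eps : 0 < eps -> exists N0, forall N, (N0 <= N)%nat ->
  forall u, 0 <= u <= 2 * PI -> norm (minus (fejer_mean N u) (phi u)) <= eps.
Proof.
  intros He. pose proof PI_RGT_0 as HPI.
  destruct (phi_chord (eps / 2)) as (d & Hd & K); [lra|].
  destruct phi_bounded as (M & HM & KM).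
  (* A chord of length [d] on the circle of radius [exp j] becomes [d'] on the unit circle, where
     the kernel estimate is stated. *)
  pose (d' := d / exp j). pose proof (exp_pos j) as Pj.
  assert (Hd' : 0 < d') by now apply Rdiv_lt_0_compat.
  pose (Q := 4 / d' ^ 2 * (2 * M)).
  assert (HQ : 0 < Q).
  { unfold Q. apply Rmult_lt_0_compat; [|lra]. apply Rdiv_lt_0_compat; [lra|].
    now apply pow_lt. }
  (* [2 Q / eps < N0 + 1] gives [Q / (N + 1) <= eps / 2] for every [N >= N0]. *)
  destruct (nfloor_ex (2 * Q / eps)) as [N0 [_ HN0]].
  { left. apply Rdiv_lt_0_compat; lra. }
  exists N0. intros N HN u Hu. apply le_INR in HN. pose proof (pos_INR N) as PN.
  pose proof (fejer_mean_convolution N u) as I1.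
  pose proof (is_integral_scal_r _ _ _ _ (phi u) (is_RInt_fejer_kernel N u)) as I2.
  pose proof (is_integral_minus _ _ _ _ _ _ I1 I2) as I3. clear I1 I2.
  (* One majorant for near and far points, so that the integral is never split. *)
  assert (I4 : is_RInt (fun t => eps / 2 * fejer_kernel N (u - t) + Q) 0 (2 * PI)
     (eps / 2 * (2 * PI * (INR N + 1)) + (2 * PI - 0) * Q)).
  { apply (@is_RInt_plus R_NormedModule).
    - apply (@is_RInt_scal R_NormedModule (fun t => fejer_kernel N (u - t)) 0 (2 * PI) (eps / 2)).
      apply is_RInt_fejer_kernel.
    - apply (@is_RInt_const R_NormedModule). }
  eapply is_integral_bound in I3; [|lra| |exact I4].
  2:{ intros t Ht.
      replace (minus _ _) with (scal (RtoC (fejer_kernel N (u - t)) : C_AbsRing) (minus (phi t) (phi u)))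
        by vring V.
      eapply Rle_trans; [apply @norm_scal|].
      change (abs (RtoC (fejer_kernel N (u - t)) : C_AbsRing)) with (Cmod (RtoC (fejer_kernel N (u - t)))).
      rewrite Cmod_R, Rabs_pos_eq by apply fejer_kernel_ge_0.
      pose proof (fejer_kernel_ge_0 N (u - t)) as Pk.
      destruct (Rlt_le_dec (Cmod (Cminus (circle_point j t) (circle_point j u))) d) as [L|L].
      - specialize (K t u Ht Hu L).
        apply Rle_trans with (fejer_kernel N (u - t) * (eps / 2)); [|lra].
        apply Rmult_le_compat_l; trivial. left; exact K.
      - assert (B : fejer_kernel N (u - t) <= 4 / d' ^ 2).
        { apply fejer_kernel_off_diagonal; trivial. unfold d'.
          apply Rmult_le_reg_r with (exp j); trivial.
          replace (d / exp j * exp j) with d by (field; lra).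
          rewrite <- (Cmod_circle_point j t), <- Cmod_mult.
          replace (Cmult (Cminus 1 (circle_point 0 (u - t))) (circle_point j t)) with
            (Cminus (circle_point j t) (circle_point j u)); trivial.
          replace (circle_point j u) with (Cmult (circle_point 0 (u - t)) (circle_point j t)).
          - ring.
          - rewrite <- circle_point_plus. f_equal; ring. }
        apply Rle_trans with Q.
        + unfold Q. apply Rmult_le_compat; trivial. apply @norm_ge_0.
          eapply Rle_trans; [apply norm_minus_le|].
          pose proof (KM t Ht). pose proof (KM u Hu).
          replace (2 * M) with (M + M) by ring. apply Rplus_le_compat; assumption.
        + assert (0 <= eps / 2 * fejer_kernel N (u - t)) by (apply Rmult_le_pos; lra). lra. }
  set (T := 2 * PI * (INR N + 1)) in *.
  assert (HT : 0 < T) by (unfold T; apply Rmult_lt_0_compat; lra).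
  replace (minus (fejer_mean N u) (phi u)) with (scal (RtoC (/ T) : C_AbsRing)
    (minus (scal (RtoC T : C_AbsRing) (fejer_mean N u)) (scal (RtoC T : C_AbsRing) (phi u)))).
  2:{ assert (ET : Cmult (RtoC (/ T)) (RtoC T) = 1%C).
      { rewrite <- RtoC_mult. f_equal. field. lra. }
      transitivity (scal (Cmult (RtoC (/ T)) (RtoC T) : C_AbsRing) (minus (fejer_mean N u) (phi u))).
      - vring V.
      - rewrite ET. vring V. }
  eapply Rle_trans; [apply @norm_scal|].
  change (abs (RtoC (/ T) : C_AbsRing)) with (Cmod (RtoC (/ T))).
  assert (HT' : 0 < / T) by now apply Rinv_0_lt_compat.
  rewrite Cmod_R, Rabs_pos_eq by lra.
  apply Rle_trans with (/ T * (eps / 2 * T + (2 * PI - 0) * Q)).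
  { apply Rmult_le_compat_l; [lra|exact I3]. }
  apply Rmult_le_reg_l with T; trivial.
  replace (T * (/ T * (eps / 2 * T + (2 * PI - 0) * Q))) with (eps / 2 * T + (2 * PI - 0) * Q)
    by (field; lra).
  assert (HQ2 : Q <= eps / 2 * (INR N + 1)).
  { apply Rmult_le_reg_l with (2 / eps); [apply Rdiv_lt_0_compat; lra|].
    replace (2 / eps * (eps / 2 * (INR N + 1))) with (INR N + 1) by (field; lra).
    replace (2 / eps * Q) with (2 * Q / eps) by (field; lra). lra. }
  apply Rmult_le_compat_l with (r := 2 * PI) in HQ2; [|lra].
  unfold T. lra.
Qed.
End FejerMeans.

(** * Laurent polynomials *)

Lemma Czpow_of_nat z m : Czpow z (Z.of_nat m) = Cpow z m.
Proof.
  destruct m as [|m]; [reflexivity|]. simpl Z.of_nat. unfold Czpow.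
  now rewrite SuccNat2Pos.id_succ.
Qed.

Lemma Czpow_opp_of_nat z m : Czpow z (- Z.of_nat m) = Cinv (Cpow z m).
Proof.
  destruct m as [|m]; [simpl; field; apply C1_nz|].
  simpl Z.of_nat. simpl Z.opp. unfold Czpow. now rewrite SuccNat2Pos.id_succ.
Qed.

Lemma Cpow_circle_point s t m : Cpow (circle_point s t) m = circle_point (INR m * s) (INR m * t).
Proof.
  induction m as [|m IH].
  - simpl. rewrite !Rmult_0_l, circle_point_0, exp_0. reflexivity.
  - rewrite Cpow_S, IH, <- circle_point_plus, S_INR. f_equal; ring.
Qed.

Lemma circle_point_neq_0 s t : circle_point s t <> RtoC 0.
Proof.
  intros E. apply (f_equal Cmod) in E. rewrite Cmod_circle_point, Cmod_0 in E.
  pose proof (exp_pos s). lra.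
Qed.

Lemma Cinv_circle_point s t : Cinv (circle_point s t) = circle_point (- s) (- t).
Proof.
  assert (H : Cmult (circle_point s t) (circle_point (- s) (- t)) = 1%C).
  { rewrite <- circle_point_plus, !Rplus_opp_r, circle_point_0, exp_0. reflexivity. }
  replace (circle_point (- s) (- t)) with
    (Cmult (Cinv (circle_point s t)) (Cmult (circle_point s t) (circle_point (- s) (- t)))).
  - rewrite H. ring.
  - field. apply circle_point_neq_0.
Qed.

Lemma Czpow_circle_point s t n :
  Czpow (circle_point s t) n = circle_point (IZR n * s) (IZR n * t).
Proof.
  destruct (Z.le_ge_cases 0 n) as [H|H].
  - rewrite <- (Z2Nat.id n H), Czpow_of_nat, Cpow_circle_point, INR_IZR_INZ. reflexivity.
  - replace n with (- Z.of_nat (Z.to_nat (- n)))%Z by lia.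
    rewrite Czpow_opp_of_nat, Cpow_circle_point, Cinv_circle_point, opp_IZR, <- INR_IZR_INZ.
    f_equal; ring.
Qed.

Lemma Czpow_succ z n : z <> RtoC 0 -> Czpow z (n + 1) = Cmult z (Czpow z n).
Proof.
  intros Hz. destruct (Z.le_gt_cases 0 n) as [H|H].
  - rewrite <- (Z2Nat.id n H). replace (Z.of_nat (Z.to_nat n) + 1)%Z with (Z.of_nat (S (Z.to_nat n))) by lia.
    rewrite !Czpow_of_nat. apply Cpow_S.
  - pose (m := Z.to_nat (- n - 1)).
    replace (n + 1)%Z with (- Z.of_nat m)%Z by lia.
    replace n with (- Z.of_nat (S m))%Z by lia.
    rewrite !Czpow_opp_of_nat, Cpow_S. field. split; trivial. now apply Cpow_nz.
Qed.

Lemma derive_of_eps {V : NormedModule C_AbsRing} (f : C_AbsRing -> V) (z : C_AbsRing) D :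
  (forall eps, 0 < eps -> exists d, 0 < d /\ forall y, Cmod (Cminus y z) < d ->
    norm (minus (minus (f y) (f z)) (scal (Cminus y z : C_AbsRing) D)) <= eps * Cmod (Cminus y z)) ->
  is_derive f z D.
Proof.
  intros H. split; [apply is_linear_scal_l|].
  intros x Hx. rewrite <- (is_filter_lim_locally_unique _ _ Hx). clear x Hx.
  intros eps. destruct (H eps (cond_pos eps)) as (d & Hd & K).
  exists (mkposreal d Hd). intros y Hy. apply K. exact Hy.
Qed.

Lemma ex_derive_scal_fct {V : NormedModule C_AbsRing} (c : C_AbsRing -> C_AbsRing)
  (g : C_AbsRing -> V) (z : C_AbsRing) :
  ex_derive c z -> ex_derive g z -> ex_derive (fun y => scal (c y) (g y)) z.
Proof.
  intros [lc Hc] [lg Hg]. exists (plus (scal lc (g z)) (scal (c z) lg)).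
  eapply filterdiff_ext_lin; [apply (filterdiff_scal_fct z c g _ _ Cmult_comm Hc Hg)|].
  intros y. simpl. change (plus (scal (Cmult y lc : C_AbsRing) (g z)) (scal (c z) (scal y lg)) =
    scal y (plus (scal lc (g z)) (scal (c z) lg))). vring V.
Qed.

Lemma Cmod_minus_sym x y : Cmod (Cminus x y) = Cmod (Cminus y x).
Proof. rewrite <- (Cmod_opp (Cminus x y)). f_equal. ring. Qed.

Lemma Cmod_triangle_minus x y : Cmod x - Cmod y <= Cmod (Cminus x y).
Proof.
  assert (H := Cmod_triangle (Cminus x y) y).
  replace (Cplus (Cminus x y) y) with x in H by ring. lra.
Qed.

Lemma ex_derive_Cinv (z : C_AbsRing) : z <> RtoC 0 ->
  ex_derive (fun y : C_AbsRing => Cinv y : C_AbsRing) z.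
Proof.
  intros Hz. exists (Copp (Cinv (Cmult z z))). apply derive_of_eps. intros eps He.
  assert (Pz : 0 < Cmod z) by now apply Cmod_gt_0.
  (* The remainder is [1/y - 1/z + (y - z)/z^2 = (y - z)^2 / (y z^2)]. With [|y| > |z| / 2] it is at
     most [2 |y - z|^2 / |z|^3]. *)
  exists (Rmin (Cmod z / 2) (eps * (Cmod z ^ 3 / 2))).
  assert (P3 : 0 < Cmod z ^ 3) by now apply pow_lt.
  split; [apply Rmin_glb_lt; [lra|]; apply Rmult_lt_0_compat; lra|].
  intros y Hy. apply Rmin_Rgt_l in Hy. destruct Hy as [H1 H2].
  assert (Hy : Cmod z / 2 < Cmod y).
  { pose proof (Cmod_triangle_minus z y) as T. rewrite Cmod_minus_sym in T. lra. }
  assert (Py : 0 < Cmod y) by lra.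
  assert (Hy0 : y <> RtoC 0) by now apply Cmod_gt_0.
  set (d := Cmod (Cminus y z)) in *. assert (d0 : 0 <= d) by apply Cmod_ge_0.
  match goal with |- norm ?x <= _ => change (norm x) with (Cmod x) end.
  change (Cmod (Cminus (Cminus (Cinv y) (Cinv z)) (Cmult (Cminus y z) (Copp (Cinv (Cmult z z))))) <= eps * d).
  replace (Cminus _ _) with (Cmult (Cmult (Cminus y z) (Cminus y z)) (Cinv (Cmult y (Cmult z z)))).
  2:{ field. split; assumption. }
  rewrite !Cmod_mult, Cmod_inv, !Cmod_mult. fold d.
  2:{ repeat apply Cmult_neq_0; assumption. }
  assert (Q : 0 < Cmod y * (Cmod z * Cmod z)) by (repeat apply Rmult_lt_0_compat; trivial).
  apply Rmult_le_reg_r with (Cmod y * (Cmod z * Cmod z)); trivial.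
  replace (d * d * / (Cmod y * (Cmod z * Cmod z)) * (Cmod y * (Cmod z * Cmod z))) with (d * d)
    by (field; lra).
  replace (eps * d * (Cmod y * (Cmod z * Cmod z))) with (d * (eps * (Cmod y * (Cmod z * Cmod z)))) by ring.
  apply Rmult_le_compat_l; trivial. left. eapply Rlt_le_trans; [exact H2|].
  apply Rmult_le_compat_l; [lra|]. simpl.
  replace (Cmod z * (Cmod z * (Cmod z * 1)) / 2) with (Cmod z / 2 * (Cmod z * Cmod z)) by field.
  apply Rmult_le_compat_r; [nra|lra].
Qed.

Lemma ex_derive_Cpow (z : C_AbsRing) m : ex_derive (fun y : C_AbsRing => Cpow y m : C_AbsRing) z.
Proof.
  induction m as [|m IH].
  - simpl. apply (@ex_derive_const C_AbsRing (AbsRing_NormedModule C_AbsRing)).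
  - eapply ex_derive_ext; [|apply (ex_derive_scal_fct (fun y => y) _ z (ex_derive_id z) IH)].
    intros y. symmetry. apply Cpow_S.
Qed.

Lemma ex_derive_comp_Cinv (f : C_AbsRing -> C_AbsRing) (z : C_AbsRing) :
  ex_derive f z -> f z <> RtoC 0 -> ex_derive (fun y => Cinv (f y) : C_AbsRing) z.
Proof.
  intros Hf H0. apply (ex_derive_comp (fun y : C_AbsRing => Cinv y : C_AbsRing) f z); trivial.
  now apply ex_derive_Cinv.
Qed.

Lemma ex_derive_Czpow (z : C_AbsRing) n : z <> RtoC 0 ->
  ex_derive (fun y : C_AbsRing => Czpow y n : C_AbsRing) z.
Proof.
  intros Hz. destruct (Z.le_ge_cases 0 n) as [H|H].
  - eapply ex_derive_ext; [|apply (ex_derive_Cpow z (Z.to_nat n))].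
    intros y. simpl. now rewrite <- Czpow_of_nat, Z2Nat.id.
  - eapply ex_derive_ext; [|apply (ex_derive_comp_Cinv _ z (ex_derive_Cpow z (Z.to_nat (- n))))].
    + intros y. simpl. rewrite <- Czpow_opp_of_nat. f_equal. lia.
    + now apply Cpow_nz.
Qed.

(** Stated over any module, so that the same sum can be formed in [B_0], in [B_1] and in the sum
    space, where it is the sum of [is_laurent_polynomial]. *)
Definition laurent_sum {V : ModuleSpace C_AbsRing} (N : nat) (b : Z -> V) (z : C_AbsRing) : V :=
  sum_n (fun k : nat => let n := (Z.of_nat k - Z.of_nat N)%Z in
                        scal (Czpow z n : C_AbsRing) (b n)) (2 * N).

Lemma ex_derive_laurent_sum {V : NormedModule C_AbsRing} N (b : Z -> V) (z : C_AbsRing) :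
  z <> RtoC 0 -> ex_derive (laurent_sum N b) z.
Proof.
  intros Hz. unfold laurent_sum.
  assert (H : forall n, ex_derive (fun y : C_AbsRing => scal (Czpow y n : C_AbsRing) (b n)) z).
  { intros n. apply (@ex_derive_scal_l C_AbsRing V). now apply ex_derive_Czpow. }
  induction (2 * N)%nat as [|M IH].
  - apply ex_derive_ext with (2 := H (Z.of_nat 0 - Z.of_nat N)%Z).
    intros y. now rewrite sum_O.
  - eapply ex_derive_ext; [|apply (@ex_derive_plus C_AbsRing V _ _ z IH (H (Z.of_nat (S M) - Z.of_nat N)%Z))].
    intros y. simpl. now rewrite sum_Sn.
Qed.

Lemma annulus_neq_0 z : annulus z -> z <> RtoC 0.
Proof. intros [H _] E. rewrite E, Cmod_0 in H. lra. Qed.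

Lemma circle_neq_0 j z : circle j z -> z <> RtoC 0.
Proof.
  intros H E. unfold circle in H. rewrite E, Cmod_0 in H. pose proof (exp_pos j). lra.
Qed.

Lemma continuous_on_laurent_sum {V : NormedModule C_AbsRing} (D : C_AbsRing -> Prop) N (b : Z -> V) :
  (forall z, D z -> z <> RtoC 0) -> continuous_on D (laurent_sum N b).
Proof.
  intros HD z Hz. eapply filterlim_filter_le_1; [apply filter_le_within|].
  apply (@ex_derive_continuous C_AbsRing V). apply ex_derive_laurent_sum. now apply HD.
Qed.

Lemma sum_n_head {G : AbelianMonoid} (g : nat -> G) N :
  sum_n g (S N) = plus (g O) (sum_n (fun k => g (S k)) N).
Proof.
  induction N as [|N IH]; [now rewrite sum_Sn, !sum_O|].
  rewrite sum_Sn, IH, sum_Sn. symmetry. apply plus_assoc.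
Qed.

Lemma laurent_sum_pad {V : ModuleSpace C_AbsRing} (b : Z -> V) N M z : (N <= M)%nat ->
  (forall n, (Z.abs n > Z.of_nat N)%Z -> b n = zero) ->
  laurent_sum M b z = laurent_sum N b z.
Proof.
  intros HNM Hb. induction HNM as [|M HNM IH]; trivial.
  rewrite <- IH. unfold laurent_sum at 1. cbv zeta.
  (* Raising the degree by one adds a term at each end, both zero here, and shifts the summation
     index of the middle part by one. *)
  replace (2 * S M)%nat with (S (S (2 * M))) by lia.
  rewrite sum_Sn, sum_n_head. rewrite !Hb by lia.
  match goal with |- plus (plus _ ?A) _ = ?B => assert (E : A = B) end.
  { apply sum_n_ext. intros k. replace (Z.of_nat (S k) - Z.of_nat (S M))%Z
      with (Z.of_nat k - Z.of_nat M)%Z by lia. reflexivity. }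
  rewrite E. vring V.
Qed.

Section Laurent.
Variable P : BanachPair.

Lemma in_intersection_iff (x : sum_space P) :
  in_intersection P x <-> (exists a, x = incl0 P a) /\ (exists b, x = incl1 P b).
Proof.
  split.
  - intros [[a Ha] [b Hb]]. split; [exists a | exists b]; now apply sum_val_inj.
  - intros [[a ->] [b H]]. split; [now exists a|]. exists b. now rewrite H.
Qed.

Lemma in_intersection_plus x y : in_intersection P x -> in_intersection P y ->
  in_intersection P (plus x y).
Proof.
  rewrite !in_intersection_iff. intros [[a ->] [b Hb]] [[a' ->] [b' Hb']]. split.
  - exists (plus a a'). symmetry. apply incl0_plus.
  - exists (plus b b'). rewrite Hb, Hb'. symmetry. apply incl1_plus.
Qed.

Lemma in_intersection_scal (c : C_AbsRing) x : in_intersection P x ->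
  in_intersection P (scal c x).
Proof.
  rewrite !in_intersection_iff. intros [[a ->] [b Hb]]. split.
  - exists (scal c a). symmetry. apply incl0_scal.
  - exists (scal c b). rewrite Hb. symmetry. apply incl1_scal.
Qed.

Lemma in_intersection_zero : in_intersection P zero.
Proof.
  split; exists zero; symmetry.
  - apply (emb_zero _ _ _ (emb0_embedding P)).
  - apply (emb_zero _ _ _ (emb1_embedding P)).
Qed.

Lemma is_laurent_polynomial_ext f g : (forall z, annulus z -> f z = g z) ->
  is_laurent_polynomial P f -> is_laurent_polynomial P g.
Proof.
  intros E (N & b & Hb & H). exists N, b. split; trivial.
  intros z Hz. rewrite <- E by exact Hz. now apply H.
Qed.

Lemma laurent_truncate N (b : Z -> sum_space P) : exists b' : Z -> sum_space P,
  (forall n, (Z.abs n <= Z.of_nat N)%Z -> b' n = b n) /\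
  (forall n, (Z.abs n > Z.of_nat N)%Z -> b' n = zero).
Proof.
  exists (fun n => if Z_le_dec (Z.abs n) (Z.of_nat N) then b n else zero).
  split; intros n Hn; destruct Z_le_dec; trivial; lia.
Qed.

(** [is_laurent_polynomial] says nothing about [b n] for [|n| > N]. With zeros there, two
    polynomials can be padded to a common degree and added coefficientwise. *)
Lemma is_laurent_polynomial_sum f : is_laurent_polynomial P f <->
  exists N (b : Z -> sum_space P), (forall n, in_intersection P (b n)) /\
    (forall n, (Z.abs n > Z.of_nat N)%Z -> b n = zero) /\
    forall z, annulus z -> f z = laurent_sum N b z.
Proof.
  split.
  - intros (N & b & Hb & Hf). destruct (laurent_truncate N b) as (b' & H1 & H2).
    exists N, b'. split; [|split; trivial].
    + intros n. destruct (Z_le_dec (Z.abs n) (Z.of_nat N)).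
      * rewrite H1 by trivial. apply Hb. lia.
      * rewrite H2 by lia. apply in_intersection_zero.
    + intros z Hz. rewrite Hf by trivial. apply sum_n_ext_loc. intros k Hk. cbv zeta.
      rewrite H1 by lia. reflexivity.
  - intros (N & b & Hb & _ & Hf). exists N, b. split; auto.
Qed.

Lemma is_laurent_polynomial_plus f g : is_laurent_polynomial P f -> is_laurent_polynomial P g ->
  is_laurent_polynomial P (fun z => plus (f z) (g z)).
Proof.
  rewrite !is_laurent_polynomial_sum.
  intros (N & b & Hb & Zb & Hf) (M & c & Hc & Zc & Hg).
  exists (N + M)%nat, (fun n => plus (b n) (c n)). split; [|split].
  - intros n. now apply in_intersection_plus.
  - intros n Hn. rewrite Zb, Zc by lia. apply plus_zero_r.
  - intros z Hz. rewrite Hf, Hg by trivial.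
    rewrite <- (@laurent_sum_pad (sum_ModuleSpace P) b N (N + M)) by (trivial; lia).
    rewrite <- (@laurent_sum_pad (sum_ModuleSpace P) c M (N + M)) by (trivial; lia).
    unfold laurent_sum. rewrite <- sum_n_plus. apply sum_n_ext. intros k. cbv zeta.
    symmetry. apply (@scal_distr_l C_AbsRing (sum_ModuleSpace P)).
Qed.

Lemma is_laurent_polynomial_monomial n x : in_intersection P x ->
  is_laurent_polynomial P (fun z => scal (Czpow z n : C_AbsRing) x).
Proof.
  intros Hx. exists (Z.to_nat (Z.abs n)), (fun m => if Z.eq_dec m n then x else zero). split.
  - intros m _. destruct Z.eq_dec; trivial. apply in_intersection_zero.
  - intros z _. set (N := Z.to_nat (Z.abs n)).
    (* The only summation index whose exponent is [n]. *)
    pose (k0 := Z.to_nat (n + Z.of_nat N)).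
    assert (E : forall M, sum_n (fun k : nat => let m := (Z.of_nat k - Z.of_nat N)%Z in
        scal (Czpow z m : C_AbsRing) (if Z.eq_dec m n then x else zero)) M =
        if le_dec k0 M then scal (Czpow z n : C_AbsRing) x else zero).
    { assert (Z0 : forall c : C_AbsRing, scal c (zero : sum_space P) = zero).
      { intros c. apply (@scal_zero_r C_AbsRing (sum_ModuleSpace P)). }
      induction M as [|M IH].
      - rewrite sum_O. cbv zeta. destruct Z.eq_dec as [e|e], le_dec; try (unfold k0 in *; lia); trivial.
        now rewrite e.
      - rewrite sum_Sn, IH. cbv zeta.
        destruct Z.eq_dec as [e|e], (le_dec k0 M), (le_dec k0 (S M)); try (unfold k0 in *; lia);
          rewrite ?Z0, ?plus_zero_l, ?plus_zero_r; trivial.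
        now rewrite e. }
    rewrite E. destruct le_dec; trivial. unfold k0, N in *. lia.
Qed.

Lemma is_laurent_polynomial_sum_n (f : nat -> C_AbsRing -> sum_space P) N :
  (forall k, is_laurent_polynomial P (f k)) ->
  is_laurent_polynomial P (fun z => sum_n (fun k => f k z) N).
Proof.
  intros H. induction N as [|N IH].
  - eapply is_laurent_polynomial_ext; [|apply (H O)]. intros z _. now rewrite sum_O.
  - eapply is_laurent_polynomial_ext; [|apply (is_laurent_polynomial_plus _ _ IH (H (S N)))].
    intros z _. now rewrite sum_Sn.
Qed.

Lemma annulus_circle j z : 0 <= j <= 1 -> circle j z -> annulus z.
Proof.
  intros Hj Hz. unfold annulus, circle in *. rewrite Hz.
  split; [rewrite <- exp_0|]; apply exp_monotone; lra.
Qed.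

Lemma locally_annulus z : annulus_interior z -> locally z annulus.
Proof.
  intros [H1 H2]. assert (Hd : 0 < Rmin (Cmod z - 1) (exp 1 - Cmod z)) by (apply Rmin_glb_lt; lra).
  exists (mkposreal _ Hd). intros y Hy. change (Cmod (Cminus y z) < Rmin (Cmod z - 1) (exp 1 - Cmod z)) in Hy.
  apply Rmin_Rgt_l in Hy. pose proof (Cmod_triangle_minus y z).
  pose proof (Cmod_triangle_minus z y) as T. rewrite Cmod_minus_sym in T. unfold annulus. lra.
Qed.

(** Pulling the coefficients back along [i] gives a Laurent sum with values in [B], continuous away
    from the origin for the norm of [B]. *)
Lemma continuous_circle_into_laurent_sum (B : NormedModule C_AbsRing) (i : B -> sum_space P)
  (j : R) N (b : Z -> sum_space P) f :
  (forall x y, i (plus x y) = plus (i x) (i y)) ->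
  (forall (a : C_AbsRing) x, i (scal a x) = scal a (i x)) ->
  0 <= j <= 1 ->
  (forall n, exists a, b n = i a) ->
  (forall z, annulus z -> f z = laurent_sum N b z) ->
  continuous_circle_into P B (fun x => sum_val (i x)) j f.
Proof.
  intros Hp Hs Hj Hb Hf. destruct (choice _ Hb) as [a Ha].
  exists (laurent_sum N a). split.
  - apply continuous_on_laurent_sum. apply circle_neq_0.
  - intros z Hz. f_equal. rewrite Hf by now apply annulus_circle with j.
    unfold laurent_sum. rewrite (sum_n_additive i) by exact Hp.
    apply sum_n_ext. intros k. cbv zeta. now rewrite Hs, <- Ha.
Qed.

(** The easy inequality of the theorem: the second infimum runs over a smaller family. *)
Lemma FA_laurent f : is_laurent_polynomial P f -> FA P f.
Proof.
  rewrite is_laurent_polynomial_sum. intros (N & b & Hb & _ & Hf).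
  split; [|split; [|split]].
  - apply (proj2 (@continuous_on_eps (sum_NormedModule P) annulus f)). intros z Hz eps He.
    assert (K : continuous_on annulus (laurent_sum (V := sum_NormedModule P) N b)).
    { apply continuous_on_laurent_sum. apply annulus_neq_0. }
    destruct (proj1 (@continuous_on_eps (sum_NormedModule P) _ _) K z Hz eps He) as (d & Hd & H).
    exists d. split; trivial. intros y Hy Hyz. rewrite !Hf by trivial. now apply H.
  - intros z Hz. apply (@ex_derive_ext_loc C_AbsRing (sum_NormedModule P) (laurent_sum N b)).
    + generalize (locally_annulus z Hz). apply filter_imp. intros y Hy. symmetry. now apply Hf.
    + apply (@ex_derive_laurent_sum (sum_NormedModule P)). apply annulus_neq_0. unfold annulus_interior, annulus in *. lra.
  - apply (continuous_circle_into_laurent_sum (banach0 P) (incl0 P) 0 N b); trivial.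
    + apply incl0_plus.
    + apply incl0_scal.
    + lra.
    + intros n. apply in_intersection_iff, Hb.
  - apply (continuous_circle_into_laurent_sum (banach1 P) (incl1 P) 1 N b); trivial.
    + apply incl1_plus.
    + apply incl1_scal.
    + lra.
    + intros n. apply in_intersection_iff, Hb.
Qed.
End Laurent.

(** * Approximation by Laurent polynomials *)

Lemma filterlim_scal_fct {T : Type} {V : NormedModule C_AbsRing} (F : (T -> Prop) -> Prop)
  {FF : Filter F} (c : T -> C_AbsRing) (g : T -> V) a v :
  filterlim c F (locally a) -> filterlim g F (locally v) ->
  filterlim (fun y => scal (c y) (g y)) F (locally (scal a v)).
Proof.
  intros Hc Hg. eapply filterlim_comp_2; [exact Hc | exact Hg|]. apply filterlim_scal.
Qed.

Lemma filterlim_minus_const {T : Type} {V : NormedModule C_AbsRing} (F : (T -> Prop) -> Prop)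
  {FF : Filter F} (g : T -> V) (v x : V) :
  filterlim g F (locally v) -> filterlim (fun y => minus (g y) x) F (locally (minus v x)).
Proof.
  intros Hg. apply (filterlim_comp_2 g (fun _ => opp x) plus Hg (filterlim_const (opp x))).
  apply (@filterlim_plus C_AbsRing V).
Qed.

Lemma ex_derive_Cinv_minus (z p : C_AbsRing) : z <> p ->
  ex_derive (fun y : C_AbsRing => Cinv (Cminus y p) : C_AbsRing) z.
Proof.
  intros Hz. apply (ex_derive_comp_Cinv (fun y => Cminus y p) z).
  - apply (@ex_derive_minus C_AbsRing (AbsRing_NormedModule C_AbsRing) (fun y => y) (fun _ => p)).
    + apply ex_derive_id.
    + apply (@ex_derive_const C_AbsRing (AbsRing_NormedModule C_AbsRing)).
  - now apply Cminus_eq_contra.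
Qed.

Lemma filterlim_Cinv_minus (z p : C_AbsRing) (D : C_AbsRing -> Prop) : z <> p ->
  filterlim (fun y : C_AbsRing => Cinv (Cminus y p) : C_AbsRing) (within D (locally z))
    (locally (Cinv (Cminus z p) : C_AbsRing)).
Proof.
  intros Hz. eapply filterlim_filter_le_1; [apply filter_le_within|].
  apply (@ex_derive_continuous C_AbsRing (AbsRing_NormedModule C_AbsRing)
    (fun y : C_AbsRing => Cinv (Cminus y p) : C_AbsRing) z).
  now apply ex_derive_Cinv_minus.
Qed.

Lemma Cmod_RtoC_exp t : Cmod (RtoC (exp t)) = exp t.
Proof. rewrite Cmod_R, Rabs_pos_eq; trivial. left; apply exp_pos. Qed.

(** * The difference quotient at [p] *)

Section DifferenceQuotient.
Context {V : NormedModule C_AbsRing}.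
Variable f : C_AbsRing -> V.
Variable p : C_AbsRing.
Variable D : V.
Hypothesis HD : is_derive f p D.

(** The value [D] at [p] makes the quotient continuous there. Differentiability is obtained only for
    [z <> p], which is the situation allowed by [annulus_circle_integrals_eq]. *)
Definition difference_quotient (z : C_AbsRing) : V :=
  if excluded_middle_informative (z = p) then D
  else scal (Cinv (Cminus z p) : C_AbsRing) (minus (f z) (f p)).

Lemma difference_quotient_spec z :
  plus (f p) (scal (Cminus z p : C_AbsRing) (difference_quotient z)) = f z.
Proof.
  unfold difference_quotient. destruct excluded_middle_informative as [->|H].
  - vring_goals V; ring.
  - transitivity (plus (f p) (scal (Cmult (Cminus z p) (Cinv (Cminus z p)) : C_AbsRing) (minus (f z) (f p)))).
    + vring V.
    + rewrite Cinv_r by now apply Cminus_eq_contra. vring V.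
Qed.

Lemma difference_quotient_neq z : z <> p ->
  locally z (fun y => scal (Cinv (Cminus y p) : C_AbsRing) (minus (f y) (f p)) = difference_quotient y).
Proof.
  intros Hz. assert (Hp : 0 < Cmod (Cminus z p)) by now apply Cmod_gt_0, Cminus_eq_contra.
  exists (mkposreal _ Hp). intros y Hy. change (Cmod (Cminus y z) < Cmod (Cminus z p)) in Hy.
  unfold difference_quotient. destruct excluded_middle_informative as [->|]; trivial.
  rewrite Cmod_minus_sym in Hy. lra.
Qed.

Lemma continuous_on_difference_quotient A : continuous_on A f -> continuous_on A difference_quotient.
Proof.
  intros Hf.
  intros z Hz. destruct (excluded_middle_informative (z = p)) as [->|Hzp].
  - eapply filterlim_filter_le_1; [apply filter_le_within|].
    apply filterlim_locally_ball_norm. intros [eps He].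
    destruct (@derive_eps V f p D HD (eps / 2)) as (d & Hd & K); [lra|].
    exists (mkposreal d Hd). intros y Hy. change (Cmod (Cminus y p) < d) in Hy.
    unfold ball_norm. simpl.
    replace (difference_quotient p) with D.
    2:{ unfold difference_quotient. now destruct excluded_middle_informative. }
    unfold difference_quotient. destruct excluded_middle_informative as [e|e].
    + apply Rle_lt_trans with 0; trivial. right. etransitivity; [|apply (@norm_zero _ V)].
      f_equal. vring V.
    + assert (Hn : 0 < Cmod (Cminus y p)) by now apply Cmod_gt_0, Cminus_eq_contra.
      specialize (K y Hy).
      match goal with |- norm ?v < _ => replace v with
        (scal (Cinv (Cminus y p) : C_AbsRing)
          (minus (minus (f y) (f p)) (scal (Cminus y p : C_AbsRing) D))) end.
      2:{ transitivity (minus (scal (Cinv (Cminus y p) : C_AbsRing) (minus (f y) (f p)))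
            (scal (Cmult (Cinv (Cminus y p)) (Cminus y p) : C_AbsRing) D)); [vring V|].
          rewrite Cinv_l by now apply Cminus_eq_contra. vring V. }
      eapply Rle_lt_trans; [apply @norm_scal|].
      change (abs (Cinv (Cminus y p) : C_AbsRing)) with (Cmod (Cinv (Cminus y p))).
      rewrite Cmod_inv by now apply Cminus_eq_contra.
      apply Rle_lt_trans with (/ Cmod (Cminus y p) * (eps / 2 * Cmod (Cminus y p))).
      * apply Rmult_le_compat_l; [|exact K]. left; now apply Rinv_0_lt_compat.
      * replace (/ Cmod (Cminus y p) * (eps / 2 * Cmod (Cminus y p))) with (eps / 2) by (field; lra).
        lra.
  - apply filterlim_ext_loc with (fun y => scal (Cinv (Cminus y p) : C_AbsRing) (minus (f y) (f p))).
    + unfold within. generalize (difference_quotient_neq z Hzp). apply filter_imp. intros y H _. exact H.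
    + replace (difference_quotient z) with (scal (Cinv (Cminus z p) : C_AbsRing) (minus (f z) (f p))).
      2:{ unfold difference_quotient. now destruct excluded_middle_informative. }
      apply (@filterlim_scal_fct _ V _ (within_filter _ _ (locally z) _)).
      * now apply filterlim_Cinv_minus.
      * apply (@filterlim_minus_const _ V _ (within_filter _ _ (locally z) _)). now apply Hf.
Qed.

Lemma ex_derive_difference_quotient z : z <> p -> ex_derive f z -> ex_derive difference_quotient z.
Proof.
  intros Hz Hf. eapply ex_derive_ext_loc; [apply (difference_quotient_neq z Hz)|].
  apply ex_derive_scal_fct; [now apply ex_derive_Cinv_minus|].
  apply @ex_derive_minus; trivial. apply @ex_derive_const.
Qed.
End DifferenceQuotient.

(** * One circle and its space [B_j], treated once for [j = 0] and [j = 1] *)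

Section CircleSide.
Variable P : BanachPair.
Variable B : CompleteNormedModule C_AbsRing.
Variable i : B -> sum_space P.
Hypothesis i_plus : forall x y, i (plus x y) = plus (i x) (i y).
Hypothesis i_scal : forall (a : C_AbsRing) x, i (scal a x) = scal a (i x).
Hypothesis i_norm : forall x, norm (i x) <= norm x.
Hypothesis i_inj : forall x y, i x = i y -> x = y.
Variables j theta : R.
Hypothesis Hj : 0 <= j <= 1.
Hypothesis Htheta : 0 < theta < 1.
Hypothesis Hjt : j <> theta.
Let p : C_AbsRing := RtoC (exp theta).
Variables f h : C_AbsRing -> sum_space P.
Variable x : sum_space P.
Hypothesis Hh : forall z, plus x (scal (Cminus z p : C_AbsRing) (h z)) = f z.

Lemma circle_neq_p z : circle j z -> z <> p.
Proof.
  intros Hz E. apply Hjt, exp_inv. unfold circle in Hz. rewrite <- Hz, E.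
  apply Cmod_RtoC_exp.
Qed.

Lemma i_minus a b : i (minus a b) = minus (i a) (i b).
Proof.
  replace (minus a b) with (plus a (scal (Copp 1 : C_AbsRing) b)) by vring B.
  rewrite i_plus, i_scal. vring (sum_ModuleSpace P).
Qed.

(** On the circle [z - p] does not vanish, so [h] is given there by [(f - x) / (z - p)]. Replacing
    [f] and [x] by their representatives in [B] yields a continuous [B]-valued function that [i]
    maps to [h]. *)
Lemma circle_trace (xj : B) : x = i xj ->
  continuous_circle_into P B (fun b => sum_val (i b)) j f ->
  exists phi : R -> B, (forall t, continuous phi t) /\
    (forall eps, 0 < eps -> exists d, 0 < d /\ forall t u,
      0 <= t <= 2 * PI -> 0 <= u <= 2 * PI ->
      Cmod (Cminus (circle_point j t) (circle_point j u)) < d ->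
      norm (minus (phi t) (phi u)) < eps) /\
    forall t, i (phi t) = h (circle_point j t).
Proof.
  intros Hx (g & Hg & Hfg).
  pose (G := fun z : C_AbsRing => scal (Cinv (Cminus z p) : C_AbsRing) (minus (g z) xj)).
  assert (HG : continuous_on (circle j) G).
  { intros z Hz. apply (@filterlim_scal_fct _ B _ (within_filter _ _ (locally z) _)).
    - apply filterlim_Cinv_minus. now apply circle_neq_p.
    - apply (@filterlim_minus_const _ B _ (within_filter _ _ (locally z) _)). now apply Hg. }
  assert (HG' := proj1 (@continuous_on_eps B _ _) HG).
  assert (Hc : forall t, circle j (circle_point j t)) by (intros; apply Cmod_circle_point).
  exists (fun t => G (circle_point j t)). split; [|split].
  - intros t. apply (@continuous_eps B). intros eps He.
    destruct (HG' _ (Hc t) eps He) as (d & Hd & K).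
    destruct (circle_point_continuous j t d Hd) as (d' & Hd' & K').
    exists d'. split; trivial. intros t' Ht'. apply K; trivial. apply K'; trivial.
    now rewrite Rminus_diag, Rabs_R0.
  - intros eps He.
    destruct (tube 0 (2 * PI) (fun t d => forall u,
      Cmod (Cminus (circle_point j t) (circle_point j u)) < d ->
      norm (minus (G (circle_point j t)) (G (circle_point j u))) < eps)) as (d & Hd & K).
    + intros t d d' Hd K u Hu. apply K. lra.
    + intros t _. destruct (HG' _ (Hc t) (eps / 2)) as (d & Hd & K); [lra|].
      (* Half of [d] moves [t] to [t'] and the other half moves [t'] to [u], so both remain within
         [d] of [t]. *)
      assert (Hd2 : 0 < d / 2) by lra.
      destruct (circle_point_continuous j t (d / 2) Hd2) as (d' & Hd' & K').
      exists (Rmin d' (d / 2)). split; [now apply Rmin_glb_lt|].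
      intros t' Ht' u Hu. apply Rmin_Rgt_l in Ht', Hu.
      assert (Kt : Cmod (Cminus (circle_point j t') (circle_point j t)) < d / 2).
      { apply K'; [now rewrite Rminus_diag, Rabs_R0|apply Ht']. }
      assert (Ku : Cmod (Cminus (circle_point j u) (circle_point j t)) < d).
      { replace (Cminus (circle_point j u) (circle_point j t)) with
          (Cplus (Cminus (circle_point j u) (circle_point j t'))
                 (Cminus (circle_point j t') (circle_point j t))) by ring.
        eapply Rle_lt_trans; [apply Cmod_triangle|].
        rewrite (Cmod_minus_sym (circle_point j u)). lra. }
      replace (minus _ _) with
        (minus (minus (G (circle_point j t')) (G (circle_point j t)))
               (minus (G (circle_point j u)) (G (circle_point j t)))) by vring B.
      eapply Rle_lt_trans; [apply norm_minus_le|].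
      replace eps with (eps / 2 + eps / 2) by field.
      apply Rplus_lt_compat; apply K; trivial. lra.
    + exists d. split; trivial. intros t u Ht _ Hu. now apply K.
  - intros t. unfold G. set (z := circle_point j t).
    assert (Hz : circle j z) by apply Hc.
    rewrite i_scal, i_minus, <- Hx.
    replace (i (g z)) with (f z) by now apply sum_val_inj, Hfg.
    rewrite <- Hh.
    transitivity (scal (Cmult (Cinv (Cminus z p)) (Cminus z p) : C_AbsRing) (h z)).
    + vring (sum_ModuleSpace P).
    + rewrite Cinv_l by now apply Cminus_eq_contra, circle_neq_p.
      vring (sum_ModuleSpace P).
Qed.

Variable phi : R -> B.
Hypothesis phi_continuous : forall t, continuous phi t.
Hypothesis i_phi : forall t, i (phi t) = h (circle_point j t).

(** The bounded map [i] passes through the integral. On the right only [h] appears, so Cauchy's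
    theorem in the sum space can compare the two circles. *)
Lemma i_fourier_coef n : i (fourier_coef j phi n) = scal (RtoC (/ (2 * PI)) : C_AbsRing)
  (@integral (sum_CompleteNormedModule P)
     (fun t => scal (Czpow (circle_point j t) (- n) : C_AbsRing) (h (circle_point j t))) 0 (2 * PI)).
Proof.
  unfold fourier_coef. rewrite i_scal. f_equal. symmetry. apply (@is_integral_unique (sum_CompleteNormedModule P)).
  apply (@is_integral_ext (sum_CompleteNormedModule P)) with
    (fun t => i (scal (circle_point (- (IZR n * j)) (- (IZR n * t)) : C_AbsRing) (phi t)) : sum_CompleteNormedModule P).
  - intros t. rewrite i_scal, i_phi, Czpow_circle_point, opp_IZR.
    apply (f_equal (fun c : C_AbsRing => scal c (h (circle_point j t)))). f_equal; ring.
  - apply (@is_integral_linear B (sum_CompleteNormedModule P) i).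
    + apply i_plus.
    + intros; apply i_scal.
    + exists 1. split; [lra|]. intros; rewrite Rmult_1_l; apply i_norm.
    + now apply is_integral_fourier.
Qed.

Variable b : Z -> sum_space P.
Hypothesis Hb : forall n, b n = i (fourier_coef j phi n).

(** The Fejer mean continued off the circle. It depends on the coefficients alone, so equal
    coefficients give one function whose restrictions are the means on both circles. *)
Definition fejer_laurent (c : Z -> sum_space P) (N : nat) (z : C_AbsRing) : sum_space P :=
  scal (RtoC (/ (INR N + 1)) : C_AbsRing)
    (double_sum (fun k l => let n := (Z.of_nat k - Z.of_nat l)%Z in
       scal (Czpow z n : C_AbsRing) (c n)) N).

Lemma i_fejer_mean N u : i (fejer_mean j phi N u) = fejer_laurent b N (circle_point j u).
Proof.
  unfold fejer_mean, fejer_laurent. rewrite i_scal. f_equal.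
  rewrite (double_sum_additive i) by exact i_plus.
  apply double_sum_ext. intros k l. cbv zeta. now rewrite i_scal, <- Hb, Czpow_circle_point.
Qed.

(** The approximant differs from [f] on the circle by [z - p] times the Fejer error, and [|z - p| <=
    exp j + exp theta <= 2 * exp 1]. Injectivity of [i] allows the estimate to be made in the norm
    of [B]. *)
Lemma circle_side_bound (xj : B) N r eps : x = i xj -> 0 <= eps ->
  (forall t a, 0 <= t < 2 * PI -> f (circle_point j t) = i a -> norm a <= r) ->
  (forall u, 0 <= u <= 2 * PI -> norm (minus (fejer_mean j phi N u) (phi u)) <= eps) ->
  forall t a, 0 <= t < 2 * PI ->
    plus x (scal (Cminus (circle_point j t) p : C_AbsRing) (fejer_laurent b N (circle_point j t))) = i a ->
    norm a <= r + 2 * exp 1 * eps.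
Proof.
  intros Hx He Hr HN t a Ht Ha.
  rewrite Hx, <- i_fejer_mean, <- i_scal, <- i_plus in Ha. apply i_inj in Ha. subst a.
  set (z := circle_point j t) in *.
  specialize (Hr t (plus xj (scal (Cminus z p : C_AbsRing) (phi t))) Ht).
  unfold z in Hr. rewrite i_plus, i_scal, i_phi, <- Hx, Hh in Hr. specialize (Hr eq_refl).
  specialize (HN t ltac:(lra)).
  replace (plus xj (scal (Cminus z p : C_AbsRing) (fejer_mean j phi N t))) with
    (plus (plus xj (scal (Cminus z p : C_AbsRing) (phi t)))
      (scal (Cminus z p : C_AbsRing) (minus (fejer_mean j phi N t) (phi t)))) by vring B.
  eapply Rle_trans; [apply @norm_triangle|]. apply Rplus_le_compat; [exact Hr|].
  eapply Rle_trans; [apply @norm_scal|]. apply Rmult_le_compat; trivial.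
  - apply abs_ge_0.
  - apply @norm_ge_0.
  - change (Cmod (Cminus z p) <= 2 * exp 1). unfold Cminus.
    eapply Rle_trans; [apply Cmod_triangle|]. unfold p, z.
    rewrite Cmod_opp, Cmod_RtoC_exp, Cmod_circle_point.
    assert (exp j <= exp 1) by (apply exp_monotone; lra).
    assert (exp theta <= exp 1) by (apply exp_monotone; lra). lra.
Qed.
End CircleSide.

(** Each term expands as [(z - p) z^n = z^(n+1) - p z^n], hence a sum of monomials with coefficients
    in the intersection. *)
Lemma is_laurent_fejer P (b : Z -> sum_space P) N x p :
  in_intersection P x -> (forall n, in_intersection P (b n)) ->
  is_laurent_polynomial P
    (fun z => plus x (scal (Cminus z p : C_AbsRing) (fejer_laurent P b N z))).
Proof.
  intros Hx Hb. set (c := RtoC (/ (INR N + 1))).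
  assert (H : forall n, is_laurent_polynomial P (fun z => plus
     (scal (Czpow z (n + 1) : C_AbsRing) (scal (c : C_AbsRing) (b n)))
     (scal (Czpow z n : C_AbsRing) (scal (Cmult (Copp p) c : C_AbsRing) (b n))))).
  { intros n. apply is_laurent_polynomial_plus; apply is_laurent_polynomial_monomial;
      apply in_intersection_scal, Hb. }
  assert (H' := is_laurent_polynomial_sum_n P _ N (fun k =>
    is_laurent_polynomial_sum_n P _ N (fun l => H (Z.of_nat k - Z.of_nat l)%Z))).
  eapply is_laurent_polynomial_ext;
    [|apply (is_laurent_polynomial_plus P _ _ (is_laurent_polynomial_monomial P 0 x Hx) H')].
  intros z Hz. simpl. f_equal.
  - apply (@scal_one C_AbsRing (sum_ModuleSpace P)).
  - unfold fejer_laurent. fold c.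
    rewrite (double_sum_additive (fun v : sum_space P => scal (c : C_AbsRing) v)).
    2:{ intros. apply (@scal_distr_l C_AbsRing (sum_ModuleSpace P)). }
    rewrite (double_sum_additive (fun v : sum_space P => scal (Cminus z p : C_AbsRing) v)).
    2:{ intros. apply (@scal_distr_l C_AbsRing (sum_ModuleSpace P)). }
    apply double_sum_ext. intros k l. cbv zeta.
    rewrite Czpow_succ by now apply annulus_neq_0. vring (sum_ModuleSpace P).
Qed.

(** * Estimates of [FA_norm] and the approximation of [f] *)

Lemma incl0_inj P a b : incl0 P a = incl0 P b -> a = b.
Proof.
  intros E. apply (f_equal sum_val) in E. now apply (emb_inj _ _ _ (emb0_embedding P)) in E.
Qed.
Lemma incl1_inj P a b : incl1 P a = incl1 P b -> a = b.
Proof.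
  intros E. apply (f_equal sum_val) in E. now apply (emb_inj _ _ _ (emb1_embedding P)) in E.
Qed.

Lemma FA_norm_bound P f r : FA_norm P f = Finite r ->
  (forall t a, 0 <= t < 2 * PI -> f (circle_point 0 t) = incl0 P a -> norm a <= r) /\
  (forall t a, 0 <= t < 2 * PI -> f (circle_point 1 t) = incl1 P a -> norm a <= r).
Proof.
  intros H. unfold FA_norm in H.
  match type of H with Lub_Rbar ?E = _ => destruct (Lub_Rbar_correct E) as [U _] end.
  rewrite H in U. split; intros t a Ht Ha; apply (U (norm a)); [left|right];
    exists t, a; (split; [exact Ht|split; [now rewrite Ha|reflexivity]]).
Qed.

(** The supremum is not [p_infty] because [r] bounds it, and not [m_infty] because the point [t = 0]
    of the inner circle contributes a norm. *)
Lemma FA_norm_le P f r : FA P f ->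
  (forall t a, 0 <= t < 2 * PI -> f (circle_point 0 t) = incl0 P a -> norm a <= r) ->
  (forall t a, 0 <= t < 2 * PI -> f (circle_point 1 t) = incl1 P a -> norm a <= r) ->
  exists r', FA_norm P f = Finite r' /\ r' <= r.
Proof.
  intros (_ & _ & (g & _ & Hg) & _) H0 H1. unfold FA_norm.
  match goal with |- context [Lub_Rbar ?E] => destruct (Lub_Rbar_correct E) as [U L];
    assert (B : is_ub_Rbar E (Finite r)) end.
  { intros s [(t & a & Ht & Ha & ->)|(t & a & Ht & Ha & ->)]; simpl;
      [apply (H0 t)|apply (H1 t)]; trivial; now apply sum_val_inj. }
  specialize (L _ B).
  assert (Hin : Rbar_le (norm (g (circle_point 0 0))) (Lub_Rbar (fun r0 : R =>
    circle_norms P (banach0 P) (emb0 P) 0 f r0 \/ circle_norms P (banach1 P) (emb1 P) 1 f r0))).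
  { apply U. left. exists 0, (g (circle_point 0 0)). split; [|split; trivial].
    - pose proof PI_RGT_0. lra.
    - apply Hg. apply Cmod_circle_point. }
  destruct (Lub_Rbar _) as [r'| |]; try contradiction. now exists r'.
Qed.

Lemma laurent_approximation P theta x f r eps :
  0 < theta < 1 -> in_intersection P x -> FA P f -> f (RtoC (exp theta)) = x ->
  FA_norm P f = Finite r -> 0 < eps ->
  exists g r', is_laurent_polynomial P g /\ g (RtoC (exp theta)) = x /\
    FA_norm P g = Finite r' /\ r' <= r + eps.
Proof.
  intros Ht Hx (Hc & Hd & C0 & C1) Hfx Hr He. set (p := RtoC (exp theta) : C_AbsRing) in *.
  destruct (FA_norm_bound P f r Hr) as [B0 B1].
  destruct (proj1 (in_intersection_iff P x) Hx) as [[x0 Hx0] [x1 Hx1]].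
  destruct (Hd p) as [D HD].
  { unfold annulus_interior, p. rewrite Cmod_RtoC_exp. split.
    - rewrite <- exp_0. apply exp_increasing; lra.
    - apply exp_increasing; lra. }
  pose (h := difference_quotient f p D).
  assert (Hh : forall z, plus x (scal (Cminus z p : C_AbsRing) (h z)) = f z).
  { intros z. rewrite <- Hfx. apply (difference_quotient_spec f p D). }
  destruct (circle_trace P (banach0 P) (incl0 P) (incl0_plus P) (incl0_scal P) 0 theta
    ltac:(lra) f h x Hh x0 Hx0 C0) as (phi0 & F0 & U0 & I0).
  destruct (circle_trace P (banach1 P) (incl1 P) (incl1_plus P) (incl1_scal P) 1 theta
    ltac:(lra) f h x Hh x1 Hx1 C1) as (phi1 & F1 & U1 & I1).
  (* Defined from the inner circle; [Hb] identifies it with the coefficient from the outer circle,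
     which puts [b n] in both spaces. *)
  pose (b := fun n => incl0 P (fourier_coef 0 phi0 n)).
  assert (Hb : forall n, b n = incl1 P (fourier_coef 1 phi1 n)).
  { intros n. unfold b.
    rewrite (i_fourier_coef P _ _ (incl0_plus P) (incl0_scal P) (incl0_norm P) 0 h phi0 F0 I0).
    rewrite (i_fourier_coef P _ _ (incl1_plus P) (incl1_scal P) (incl1_norm P) 1 h phi1 F1 I1).
    f_equal.
    apply (@annulus_circle_integrals_eq (sum_CompleteNormedModule P)
      (fun z => scal (Czpow z (- n) : C_AbsRing) (h z)) theta Ht).
    - intros z Hz. apply (@filterlim_scal_fct _ (sum_NormedModule P) _ (within_filter _ _ (locally z) _)).
      + eapply filterlim_filter_le_1; [apply filter_le_within|].
        apply (@ex_derive_continuous C_AbsRing (AbsRing_NormedModule C_AbsRing)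
          (fun y : C_AbsRing => Czpow y (- n) : C_AbsRing) z).
        now apply ex_derive_Czpow, annulus_neq_0.
      + now apply (continuous_on_difference_quotient f p D HD annulus Hc).
    - intros z Hz Hzp. apply (@ex_derive_scal_fct (sum_NormedModule P)).
      + apply ex_derive_Czpow, annulus_neq_0. unfold annulus, annulus_interior in *. lra.
      + apply ex_derive_difference_quotient; trivial. now apply Hd. }
  assert (Hb' : forall n, in_intersection P (b n)).
  { intros n. apply in_intersection_iff. split; eexists; [reflexivity|apply Hb]. }
  pose proof (exp_pos 1) as Pe.
  (* The tolerance anticipates the factor [2 * exp 1] of [circle_side_bound]. *)
  assert (He' : 0 < eps / (2 * exp 1)) by (apply Rdiv_lt_0_compat; lra).
  destruct (fejer_mean_converges 0 phi0 F0 U0 _ He') as [N0 K0].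
  destruct (fejer_mean_converges 1 phi1 F1 U1 _ He') as [N1 K1].
  specialize (K0 (N0 + N1)%nat ltac:(lia)). specialize (K1 (N0 + N1)%nat ltac:(lia)).
  set (N := (N0 + N1)%nat) in *.
  pose (g := fun z => plus x (scal (Cminus z p : C_AbsRing) (fejer_laurent P b N z))).
  assert (Lg : is_laurent_polynomial P g) by now apply is_laurent_fejer.
  assert (Ee : 2 * exp 1 * (eps / (2 * exp 1)) = eps) by (field; lra).
  destruct (FA_norm_le P g (r + eps)) as (r' & Hr' & Hle).
  - now apply FA_laurent.
  - rewrite <- Ee.
    apply (circle_side_bound P (banach0 P) (incl0 P) (incl0_plus P) (incl0_scal P)
      (incl0_inj P) 0 theta ltac:(lra) Ht f h x Hh phi0 I0 b (fun n => eq_refl) x0); trivial. lra.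
  - rewrite <- Ee.
    apply (circle_side_bound P (banach1 P) (incl1 P) (incl1_plus P) (incl1_scal P)
      (incl1_inj P) 1 theta ltac:(lra) Ht f h x Hh phi1 I1 b Hb x1); trivial. lra.
  - exists g, r'. split; [|split; [|split]]; trivial.
    (* At [z = p] the factor [z - p] kills the Fejer part, so the value is exactly [x]. *)
    unfold g. vring_goals (sum_ModuleSpace P); ring.
Qed.

Theorem mainTheorem4 (P : BanachPair) (theta : R) (x : sum_space P) :
  0 < theta < 1 ->
  in_intersection P x ->
  interp_norm P theta x =
  Glb_Rbar (fun r => exists f : C_AbsRing -> sum_space P,
    is_laurent_polynomial P f /\ f (RtoC (exp theta)) = x /\
    FA_norm P f = Finite r).
Proof.
  intros Ht Hx. apply Rbar_le_antisym.
  - apply Glb_Rbar_correct. intros r (f & Hf & Hfx & Hr).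
    apply (proj1 (Glb_Rbar_correct _)). exists f. split; [|split]; trivial. now apply FA_laurent.
  - apply Glb_Rbar_correct. intros r (f & Hf & Hfx & Hr).
    set (S := fun r => _).
    assert (K : forall eps, 0 < eps -> Rbar_le (Glb_Rbar S) (Finite (r + eps))).
    { intros eps He.
      destruct (laurent_approximation P theta x f r eps) as (g & r' & Hg & Hgx & Hr' & L); trivial.
      apply Rbar_le_trans with (Finite r'); [|exact L].
      apply (proj1 (Glb_Rbar_correct S)). exists g. auto. }
    (* A finite infimum is handled by letting [eps] tend to 0; [p_infty] contradicts the single
       instance [K 1], and [m_infty] lies below every value. *)
    destruct (Glb_Rbar S) as [s| |]; simpl in *; trivial.
    + now apply le_epsilon.
    + apply (K 1). lra.
Qed.
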